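(* Let $\gamma\in[0,n)$ and let $\rho:\mathbb{R}^n\setminus\{0\}\to\mathbb{R}$ be defined by $\rho(x)=\frac{1}{|x|^\gamma}$. Let $\beta>0$ and set $\alpha=\beta\,\frac{n-\gamma}{n}$. Then the functional $$\mathcal{BS}_{\alpha,\beta,\rho,1}(\Phi)=\Bigl(\int_{\mathbb{R}^n} e^{-\alpha\Phi}\rho\,dx\Bigr)^{1/\alpha}\Bigl(\int_{\mathbb{R}^n} e^{-\beta\Phi^*}\,dy\Bigr)^{1/\beta},\qquad\Phi\in\mathcal{C},$$ admits a radially symmetric maximizer, i.e. there is a radially symmetric $\Phi_0\in\mathcal{C}$ with $\mathcal{BS}_{\alpha,\beta,\rho,1}(\Phi_0)=\sup_{\Phi\in\mathcal{C}}\mathcal{BS}_{\alpha,\beta,\rho,1}(\Phi)$.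
   Context: $\mathcal{C}$ is the class of lower semicontinuous, even, convex functions $\Phi:\mathbb{R}^n\to\mathbb{R}\cup\{+\infty\}$ such that $\{\Phi<\infty\}$ has non-empty interior and $\lim_{|x|\to\infty}\Phi(x)=+\infty$. $\Phi^*(y)=\sup_x(\langle x,y\rangle-\Phi(x))$ is the Legendre transform. $|x|$ is the Euclidean norm. *)

(* Defs.v *)
From HB Require Import structures.
From mathcomp Require Import all_boot all_order all_algebra.
From mathcomp Require Import all_classical all_reals all_analysis.
Set Implicit Arguments.
Unset Strict Implicit.
Unset Printing Implicit Defensive.
Import Order.TTheory GRing.Theory Num.Theory.
Import numFieldTopology.Exports numFieldNormedType.Exports.
Local Open Scope classical_set_scope.
Local Open Scope ring_scope.

(* R^n is 'rV[R]_n.  Its library topology comes from the sup norm, hence is the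
   usual one; the library norm `|x| is NOT the Euclidean one. *)

(* The product sigma-algebra on T^n; for T = R these are the Borel sets. *)
Definition measure_rV_display : measure_display -> measure_display.
Proof. exact. Qed.

Section measurable_rV.
Context {d} {T : measurableType d}.
Variable n : nat.

Let coord (i : 'I_n) (x : 'rV[T]_n) : T := x ord0 i.

HB.instance Definition _ :=
  @isMeasurable.Build (measure_rV_display d) 'rV[T]_n
    (g_sigma_preimage coord) (@sigma_algebra0 _ setT _) (@sigma_algebraC _ _)
    (@sigma_algebra_bigcup _ setT _).

Lemma measurable_coord (i : 'I_n) :
  measurable_fun [set: 'rV[T]_n] (fun x : 'rV[T]_n => x ord0 i).
Proof.
move=> _ Y mY; rewrite setTI; apply: sub_sigma_algebra => /=.
rewrite -bigcup_seq/=; exists i => /=; first by rewrite mem_index_enum.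
by exists Y => //; rewrite setTI.
Qed.

Lemma measurable_fun_coordP d1 (T1 : measurableType d1) (f : T1 -> 'rV[T]_n) :
  (forall i, measurable_fun [set: T1] (fun t => f t ord0 i)) ->
  measurable_fun [set: T1] f.
Proof.
move=> mf _ Y mY; rewrite setTI; move: Y mY.
apply: smallest_sub.
  split.
  - by rewrite /= preimage_set0.
  - by move=> A mA; rewrite /= setTD preimage_setC; exact: measurableC.
  - by move=> F mF; rewrite /= preimage_bigcup; exact: bigcup_measurable.
move=> A; rewrite -bigcup_seq => -[i _ [B mB <-]] /=.
by rewrite setTI; have := mf i measurableT B mB; rewrite setTI.
Qed.

End measurable_rV.

Definition rV_cons {R : Type} {n : nat} (p : R * 'rV[R]_n) : 'rV[R]_n.+1 :=
  \row_i oapp (p.2 ord0) p.1 (unlift ord0 i).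

Section lebesgue_rV.
Context {R : realType}.
Local Open Scope ereal_scope.

Lemma rV_cons0 n (p : R * 'rV[R]_n) : rV_cons p ord0 ord0 = p.1.
Proof. by rewrite mxE unlift_none. Qed.

Lemma rV_consS n (p : R * 'rV[R]_n) (i : 'I_n) :
  rV_cons p ord0 (lift ord0 i) = p.2 ord0 i.
Proof. by rewrite mxE liftK. Qed.

Lemma measurable_rV_cons n : measurable_fun [set: R * 'rV[R]_n] (@rV_cons R n).
Proof.
apply: measurable_fun_coordP => i; have [j ->|->] := unliftP ord0 i; last first.
  by under eq_fun do rewrite rV_cons0; exact: measurable_fst.
under eq_fun do rewrite rV_consS.
by apply: (measurableT_comp (measurable_coord j)); exact: measurable_snd.
Qed.

(* n-dimensional Lebesgue measure, as the n-fold product of the one-dimensional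
   one, carried over by the identification R * R^n = R^(n+1). *)
Fixpoint lebesgue_rV (n : nat) : set 'rV[R]_n -> \bar R :=
  match n with
  | 0 => \d_(0%R : 'rV[R]_0)
  | m.+1 => pushforward (lebesgue_measure \x @lebesgue_rV m) (@rV_cons R m)
  end.

Let ind (n : nat) (mu : set 'rV[R]_n -> \bar R) :=
  exists m : {sigma_finite_measure set 'rV[R]_n -> \bar R}, mu = m.

Let ind0 : ind (\d_(0%R : 'rV[R]_0)).
Proof. by exists (\d_(0%R : 'rV[R]_0)). Qed.

Let cyl n (A : set R) (B : set 'rV[R]_n) : set 'rV[R]_n.+1 :=
  [set x | A (x ord0 ord0) /\ B (\row_i x ord0 (lift ord0 i))].

Let measurable_cyl n A (B : set 'rV[R]_n) :
  measurable A -> measurable B -> measurable (cyl A B).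
Proof.
move=> mA mB.
have h0 := @measurable_coord _ R n.+1 ord0.
have hr : measurable_fun [set: 'rV[R]_n.+1]
    (fun x : 'rV[R]_n.+1 => \row_i x ord0 (lift ord0 i) : 'rV[R]_n).
  apply: measurable_fun_coordP => i; under eq_fun do rewrite mxE.
  exact: measurable_coord.
rewrite (_ : cyl A B = ([set: 'rV[R]_n.+1] `&` (fun x => x ord0 ord0) @^-1` A)
  `&` ([set: 'rV[R]_n.+1] `&`
       (fun x => \row_i x ord0 (lift ord0 i)) @^-1` B)); last first.
  by rewrite !setTI.
by apply: measurableI; [exact: h0|exact: hr].
Qed.

Let preimage_cyl n A (B : set 'rV[R]_n) : @rV_cons R n @^-1` cyl A B = A `*` B.
Proof.
apply/seteqP; split => -[a x]; rewrite /cyl /= rV_cons0;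
  rewrite (_ : \row_i _ = x)//; apply/rowP => i; by rewrite mxE rV_consS.
Qed.

Let indS n : ind (@lebesgue_rV n) -> ind (@lebesgue_rV n.+1).
Proof.
move=> [m e]; rewrite /ind /= e.
pose P := (@lebesgue_measure R \x m).
have sf : sigma_finite setT (pushforward P (@rV_cons R n)).
  have /sigma_finiteP[F [TF ndF Foo]] := sigma_finiteT (@lebesgue_measure R).
  have /sigma_finiteP[G [TG ndG Goo]] := sigma_finiteT m.
  exists (fun k => cyl (F k) (G k)).
    apply/seteqP; split => // x _.
    have : (\bigcup_i F i) (x ord0 ord0) by rewrite -TF.
    move=> [i _ Fi].
    have : (\bigcup_i G i) (\row_i x ord0 (lift ord0 i)) by rewrite -TG.
    move=> [j _ Gj]; exists (maxn i j) => //; split.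
    - by move: Fi; exact/subsetPset/ndF/leq_maxl.
    - by move: Gj; exact/subsetPset/ndG/leq_maxr.
  move=> k; have [? ?] := Foo k; have [? ?] := Goo k.
  split; first exact: measurable_cyl.
  rewrite /pushforward preimage_cyl /P product_measure1E//.
  by rewrite lte_mul_pinfty// ge0_fin_numE.
pose mP : {measure set 'rV[R]_n.+1 -> \bar R} :=
  measure_function_pushforward__canonical__measure_function_Measure
    P (@measurable_rV_cons n).
pose sP := Measure_isSigmaFinite.Build _ _ _ mP sf.
pose mS : {sigma_finite_measure set 'rV[R]_n.+1 -> \bar R} :=
  HB.pack (mP : set _ -> \bar R) (Measure.class mP) sP.
by exists mS.
Qed.

Let indP n : ind (@lebesgue_rV n).
Proof. by elim: n => [|n /indS//]; exact: ind0. Qed.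

Let lebesgue_rV_set0 n : @lebesgue_rV n set0 = 0.
Proof. by have [m ->] := indP n. Qed.

Let lebesgue_rV_ge0 n A : 0 <= @lebesgue_rV n A.
Proof. by have [m ->] := indP n. Qed.

Let lebesgue_rV_sigma_additive n : semi_sigma_additive (@lebesgue_rV n).
Proof. by have [m ->] := indP n; exact: measure_semi_sigma_additive. Qed.

HB.instance Definition _ n := isMeasure.Build _ _ _ (@lebesgue_rV n)
  (lebesgue_rV_set0 n) (@lebesgue_rV_ge0 n) (@lebesgue_rV_sigma_additive n).

Let lebesgue_rV_sigma_finite n : sigma_finite setT (@lebesgue_rV n).
Proof. by have [m ->] := indP n; exact: sigma_finiteT. Qed.

HB.instance Definition _ n := Measure_isSigmaFinite.Build _ _ _ (@lebesgue_rV n)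
  (lebesgue_rV_sigma_finite n).

Lemma lebesgue_rV_box n (a b : 'I_n -> R) : (forall i, a i <= b i)%R ->
  lebesgue_rV [set x : 'rV[R]_n | forall i, x ord0 i \in `[a i, b i]]
  = (\prod_i (b i - a i))%:E.
Proof.
elim: n a b => [|n IH] a b ab.
  rewrite big_ord0 /= diracE (_ : _ \in _)//.
  by rewrite inE /= => -[].
rewrite big_ord_recl EFinM -IH//=.
rewrite (_ : [set x | _] = cyl `[a ord0, b ord0]
   [set x : 'rV[R]_n | forall i, x ord0 i \in
     `[a (lift ord0 i), b (lift ord0 i)]]).
  have [m e] := indP n.
  rewrite /pushforward preimage_cyl e product_measure1E//.
    congr (_ * _); rewrite [LHS](lebesgue_measure_itv `[a ord0, b ord0])/=.
    rewrite lte_fin lt_neqAle ab andbT.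
    case: eqVneq => [->|_]; first by rewrite subrr.
    by rewrite EFinB.
  rewrite (_ : [set x | _] = \bigcap_(i in [set: 'I_n])
    ([set: 'rV[R]_n] `&` (fun x : 'rV[R]_n => x ord0 i) @^-1`
       `[a (lift ord0 i), b (lift ord0 i)])).
    apply: fin_bigcap_measurable; first exact: finite_finset.
    by move=> i _; exact: measurable_coord.
  apply/seteqP; split => x /= h i; first by move=> _; split => //; exact: h.
  by have [//|_] := h i.
apply/seteqP; split => x /=.
  by move=> h; split=> [|i]; rewrite ?mxE; exact: h.
move=> [h0 h] i; have [j ->|->] := unliftP ord0 i; last exact: h0.
by have := h j; rewrite mxE.
Qed.

End lebesgue_rV.
Arguments lebesgue_rV {R} n.

Section functional.
Context {R : realType} {n : nat}.
Implicit Types (x y : 'rV[R]_n) (Phi : 'rV[R]_n -> \bar R).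
Local Open Scope ereal_scope.

Definition dot x y : R := (\sum_i x ord0 i * y ord0 i)%R.

Definition enorm x : R := Num.sqrt (dot x x).

Definition even_fun Phi := forall x, Phi (- x)%R = Phi x.

Definition econvex Phi := forall x y (t : R), (0 <= t <= 1)%R ->
  Phi (t *: x + (1 - t) *: y)%R <= t%:E * Phi x + (1 - t)%:E * Phi y.

Definition coercive Phi := forall M : R, exists r : R,
  forall x, (r < enorm x)%R -> M%:E < Phi x.

Record class_C Phi : Prop := ClassC {
  class_C_gtNy : forall x, -oo < Phi x;
  class_C_lsc : lower_semicontinuous Phi;
  class_C_even : even_fun Phi;
  class_C_convex : econvex Phi;
  class_C_dom : ([set x | Phi x < +oo]°)%classic !=set0;
  class_C_coercive : coercive Phi }.

Definition legendre Phi y : \bar R :=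
  ereal_sup [set (dot x y)%:E - Phi x | x in [set: 'rV[R]_n]].

Definition radial Phi := forall x y, enorm x = enorm y -> Phi x = Phi y.

Definition rho (gamma : R) x : R := (1 / (enorm x `^ gamma))%R.

(* The weight is only meaningful off the origin, which is a null set when
   n > 0: the value that the total function w takes at 0 is not used. *)
Definition BS (alpha beta : R) (w : 'rV[R]_n -> R) Phi : \bar R :=
  (\int[lebesgue_rV n]_(x in ~` [set 0%R])
     (expeR (- (alpha%:E * Phi x)) * (w x)%:E)) `^ (1 / alpha)%R *
  (\int[lebesgue_rV n]_y expeR (- (beta%:E * legendre Phi y))) `^ (1 / beta)%R.

End functional.

(* Main.v *)
(* Put theta = (n - gamma) / n, so that alpha = theta beta, and l = 1 / (1 + theta).
   The maximizer is Phi0(x) = l |x|^(1/l), and a direct chain of inequalities,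
   each an equality for Phi0, bounds the functional.

   Blaschke-Santalo (|K||L| <= c^n omega^2 for symmetric K, L with <x, y> <= c on
   K x L) is applied to the sublevel sets K_s = {Phi <= s}, L_t = {Phi^* <= t},
   with c = s + t.  The weight |x|^(-gamma) is radially decreasing, so balls
   maximize the weighted volume w among sets of given volume (bathtub), which
   turns this into w(K_s) |L_t|^theta <= const (s + t)^(n - gamma).  The two
   integrals are integrals of exponentials against s |-> w(K_s) and t |-> |L_t|,
   so the one-dimensional Prekopa-Leindler inequality concludes: all three of its
   functions become dilates of c^m e^(-k c) when Phi = Phi0.

   Blaschke-Santalo for sets follows from the functional form
   f(x) g(y) <= e^(-2 <x, y>) ==> int f int g <= (int e^(-|x|^2))^2 for even f, g.
   That one is proved by induction on the dimension: integrating f in its first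
   variable is a functional Steiner symmetrization, and the mass of the
   correspondingly symmetrized polar of g does not decrease, by Prekopa-Leindler
   with exponent 1/2 on the slices g(t, .) and g(-t, .).  The remaining
   one-dimensional inequality is multiplicative Prekopa-Leindler, i.e. the
   additive one after the substitution u = e^a. *)
Require Import Defs.
From HB Require Import structures.
From mathcomp Require Import all_boot all_order all_algebra.
From mathcomp Require Import all_classical all_reals all_analysis.
From mathcomp Require Import measurable_realfun ring lra.
Set Implicit Arguments.
Unset Strict Implicit.
Unset Printing Implicit Defensive.
Import Order.TTheory GRing.Theory Num.Theory.
Import numFieldTopology.Exports numFieldNormedType.Exports.
Local Open Scope classical_set_scope.
Local Open Scope ring_scope.

(** The exponents are dictated by homogeneity. Weighted volume has degree n - gamma and volume has
    degree n, so theta gives |L|^theta the degree of w, and the radius of the ball that replaces K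
    cancels. Raising the set inequality to the power l produces the exponents l and theta l = 1 - l,
    the weights of a Prekopa-Leindler inequality. Finally alpha = theta beta means alpha l = beta (1
    - l) = k: the factor e^(-alpha s l) e^(-beta t (1 - l)) depends on s + t alone, and the
    functional is the power 1/k of X^l Y^(1 - l), where X and Y are the two integrals. Since only s
    + t occurs, Prekopa-Leindler is used with h(x + y) instead of a convex combination, at the price
    of the constant l^l (1 - l)^(1 - l). All integrals stay in the extended nonnegative reals; the
    upper bound and the lower bound at Phi0 are the same expression, compared without evaluating it.
    Blaschke-Santalo is proved in Gaussian form because Gaussians split over coordinates, which
    suits induction on the dimension; mixing the dilates of a set with a weight that turns the unit
    ball into a Gaussian leads back to sets. *)

(* The library's Lebesgue measure lives on [measurableTypeR R], whose measurable
   structure is not the canonical one of [R]; [leb] is its transport to [R]. *)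
Definition leb {R : realType} (A : set R) : \bar R := @lebesgue_measure R A.

Section leb.
Context {R : realType}.
Local Open Scope ereal_scope.

Let leb0 : @leb R set0 = 0. Proof. exact: measure0. Qed.

Let leb_ge0 (A : set R) : 0 <= leb A. Proof. exact: measure_ge0. Qed.

Let leb_sigma_additive : semi_sigma_additive (@leb R).
Proof. exact: (@measure_semi_sigma_additive _ _ _ (@lebesgue_measure R)). Qed.

HB.instance Definition _ := isMeasure.Build _ _ _ (@leb R)
  leb0 leb_ge0 leb_sigma_additive.

Let leb_sigma_finite : sigma_finite setT (@leb R).
Proof. exact: (sigma_finiteT (@lebesgue_measure R)). Qed.

HB.instance Definition _ := Measure_isSigmaFinite.Build _ _ _ (@leb R)
  leb_sigma_finite.

Lemma measurable_idR : measurable_fun [set: measurableTypeR R] (@id R).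
Proof. by move=> _ A mA; rewrite setTI. Qed.

Lemma integral_leb (D : set R) (f : R -> \bar R) : measurable D ->
  measurable_fun D f -> {in D, forall x, 0 <= f x} ->
  \int[leb]_(x in D) f x = \int[lebesgue_measure]_(x in D) f x.
Proof.
move=> mD mf f0.
exact: (ge0_integral_pushforward measurable_idR (@lebesgue_measure R) mD mf f0).
Qed.

Lemma leb_itv (i : interval R) :
  leb [set` i] = if i.1 < i.2 then (i.2 : \bar R) - i.1 else 0.
Proof. exact: lebesgue_measure_itv. Qed.

End leb.

(** * Indicators, Tonelli and the layer cake formula *)

Section ebool.
Context {R : realType} {d} {T : measurableType d}.
Local Open Scope ereal_scope.

Definition ebool (b : bool) : \bar R := (b%:R)%:E.

Lemma ebool_and (a b : bool) : ebool a * ebool b = ebool (a && b).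
Proof. by rewrite /ebool -EFinM -natrM mulnb. Qed.

Lemma measurable_bool_set (f : T -> bool) :
  measurable_fun [set: T] f -> measurable [set x | f x].
Proof.
move=> mf; rewrite [X in measurable X](_ : _ = setT `&` f @^-1` [set true]).
  by apply: mf.
by rewrite setTI.
Qed.

Lemma measurable_ebool (f : T -> bool) :
  measurable_fun [set: T] f ->
  measurable_fun [set: T] (fun x => ebool (f x)).
Proof.
move=> mf; apply/measurable_EFinP.
rewrite (_ : (fun x => _) = \1_[set x | f x]).
  exact/measurable_indic/measurable_bool_set.
apply/funext => x; rewrite indicE; case: (boolP (f x)) => fx.
- by rewrite mem_set.
- by rewrite memNset//=; apply/negP.
Qed.

Lemma integral_ebool (mu : {measure set T -> \bar R}) (f : T -> bool) :
  measurable_fun [set: T] f ->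
  \int[mu]_x ebool (f x) = mu [set x | f x].
Proof.
move=> mf; transitivity (\int[mu]_x ((\1_[set x | f x] x)%:E)).
  apply: eq_integral => x _; rewrite indicE; case: (boolP (f x)) => fx.
  - by rewrite mem_set.
  - by rewrite memNset//=; apply/negP.
by rewrite integral_indic ?setIT//; exact: measurable_bool_set.
Qed.

Lemma ebool_ge0 (b : bool) : 0 <= ebool b.
Proof. by rewrite lee_fin. Qed.

End ebool.

Section tonelli_indicator.
Context {R : realType}.
Local Open Scope ereal_scope.

(** The common form of all layer decompositions below: [w] weighs the points, [k] weighs the levels,
    and [P] says which layers contain which points. *)
Lemma tonelli_indicator {d} {T : measurableType d} (mu : {sigma_finite_measure set T -> \bar R})
    (w : T -> \bar R) (k : R -> \bar R) (P : T * R -> bool) :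
  measurable_fun [set: T] w -> measurable_fun [set: R] k ->
  measurable_fun [set: T * R] P ->
  (forall x, 0 <= w x) -> (forall t, 0 <= k t) ->
  \int[mu]_x (w x * \int[leb]_t (k t * ebool (P (x, t)))) =
  \int[leb]_t (k t * \int[mu]_x (w x * ebool (P (x, t)))).
Proof.
move=> mw mk mP w0 k0.
have mP1 x : measurable_fun [set: R] (fun t => ebool (P (x, t)) : \bar R).
  by apply: measurable_ebool; apply: measurableT_comp mP _; exact: measurable_fun_pair.
have mP2 t : measurable_fun [set: T] (fun x => ebool (P (x, t)) : \bar R).
  apply: (measurable_ebool (f := fun x => P (x, t))).
  by apply: measurableT_comp mP _; exact: measurable_fun_pair.
transitivity (\int[mu]_x \int[leb]_t
    (w x * (k t * ebool (P (x, t))))).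
  apply: eq_integral => x _; rewrite ge0_integralZl//.
  - exact: emeasurable_funM.
  - by move=> t _; rewrite mule_ge0// ebool_ge0.
transitivity (\int[leb]_t \int[mu]_x
    (w x * (k t * ebool (P (x, t))))).
  apply: (fubini_tonelli
    (fun p : T * R => w p.1 * (k p.2 * ebool (P (p.1, p.2))))).
  - apply: emeasurable_funM; first exact: measurableT_comp.
    apply: emeasurable_funM; first exact: measurableT_comp.
    apply: (measurable_ebool (f := fun p => P (p.1, p.2))).
    by apply: eq_measurable_fun mP => -[].
  - by move=> p; rewrite !mule_ge0// ebool_ge0.
apply: eq_integral => t _; rewrite -ge0_integralZl//.
- by apply: eq_integral => x _; rewrite muleCA.
- exact: emeasurable_funM.
- by move=> x _; rewrite mule_ge0// ebool_ge0.
Qed.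

Lemma integral_itv0 (a : \bar R) : 0 <= a ->
  \int[leb]_t
    (ebool (0 < t)%R * ebool (t%:E < a)) = a.
Proof.
move=> a0.
under eq_integral do rewrite ebool_and.
rewrite (integral_ebool leb (f := fun t => (0 < t)%R && (t%:E < a))).
  case: a a0 => [a||]// a0.
  - rewrite (_ : [set x | _] = `]0%R, a[%classic).
      rewrite [LHS]leb_itv/= lte_fin; case: ltP => [_|a0'].
        by rewrite sube0.
      by congr EFin; apply/eqP; rewrite eq_le a0' -lee_fin a0.
    by apply/seteqP; split => t /=; rewrite in_itv/= lte_fin.
  - rewrite (_ : [set x | _] = `]0%R, +oo[%classic).
      by rewrite [LHS]leb_itv/= lt0y.
    by apply/seteqP; split => t /=; rewrite in_itv/= ltry andbT.
apply: measurable_and.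
  exact: measurable_fun_ltr.
by apply: measurable_fun_lte => //; exact/measurable_EFinP.
Qed.

Lemma layer_cake {d} {T : measurableType d} (mu : {sigma_finite_measure set T -> \bar R})
    (f : T -> \bar R) : measurable_fun [set: T] f -> (forall x, 0 <= f x) ->
  \int[mu]_x f x = \int[leb]_t
    (ebool (0 < t)%R * mu [set x | t%:E < f x]).
Proof.
move=> mf f0.
have mP : measurable_fun [set: T * R] (fun p : T * R => p.2%:E < f p.1).
  apply: measurable_fun_lte; first by apply/measurable_EFinP.
  exact: measurableT_comp.
transitivity (\int[mu]_x (1 * \int[leb]_t
    (ebool (0 < t)%R * ebool (t%:E < f x)))).
  by apply: eq_integral => x _; rewrite mul1e integral_itv0.
rewrite (tonelli_indicator mu (w := cst 1)
  (k := fun t => ebool (0 < t)%R) (P := fun p => p.2%:E < f p.1))//; last 2 first.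
- by apply: measurable_ebool; exact: measurable_fun_ltr.
- by move=> t; exact: ebool_ge0.
apply: eq_integral => t _ /=; congr (_ * _).
under eq_integral do rewrite mul1e.
rewrite (integral_ebool _ (f := fun x => t%:E < f x))//.
by apply: measurable_fun_lte.
Qed.

End tonelli_indicator.

(** * Affine changes of variable on the line *)

Section affine.
Context {R : realType}.
Local Open Scope ereal_scope.

Let aff (c d : R) (x : measurableTypeR R) : measurableTypeR R := (c * x + d)%R.

Let measurable_aff c d : measurable_fun setT (aff c d).
Proof.
have : measurable_fun [set: R] (fun x : R => c * x + d)%R.
  by apply: measurable_funD => //; exact: measurable_funM.
by move=> m _ A mA; exact: m.
Qed.

(** Uniqueness of Lebesgue measure: the rescaled image measure agrees with it on half-open
    intervals. *)
Lemma leb_affine (A : set R) (c d : R) : (0 < c)%R -> measurable A ->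
  leb A = c%:E * leb [set x | A (c * x + d)%R].
Proof.
move=> c0 mA.
pose P : {measure set (measurableTypeR R) -> \bar R} :=
  measure_function_pushforward__canonical__measure_function_Measure
    (@lebesgue_measure R) (measurable_aff c d).
pose M : {measure set (measurableTypeR R) -> \bar R} := mscale (NngNum (ltW c0)) P.
rewrite -[RHS]/(M A); apply: (@lebesgue_measure_unique R M) => // _ [[a b] _ <-] /=.
rewrite /mscale/= /pushforward.
rewrite (_ : aff c d @^-1` _ = `]((a - d) / c)%R, ((b - d) / c)%R]%classic); last first.
  apply/seteqP; split => x /=; rewrite /aff !in_itv/=;
    by rewrite ltr_pdivrMr// ler_pdivlMr// ltrBlDr lerBrDr (mulrC c).
rewrite [LHS]lebesgue_measure_itv/= [X in _ * X]lebesgue_measure_itv/= !lte_fin.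
rewrite ltr_pM2r ?invr_gt0// ltrD2r; case: ifPn => _; last by rewrite mule0.
by rewrite -!EFinB -EFinM; congr EFin; field; rewrite gt_eqF.
Qed.

Lemma integral_affine_pos (f : R -> \bar R) (c d : R) : (0 < c)%R ->
  measurable_fun [set: R] f -> (forall x, 0 <= f x) ->
  \int[leb]_x f x = c%:E * \int[leb]_x f (c * x + d)%R.
Proof.
move=> c0 mf f0.
have mphi : measurable_fun [set: R] (fun x : R => c * x + d)%R.
  by apply: measurable_funD => //; exact: measurable_funM.
pose P : {measure set R -> \bar R} :=
  measure_function_pushforward__canonical__measure_function_Measure leb mphi.
pose M : {measure set R -> \bar R} := mscale (NngNum (ltW c0)) P.
transitivity (\int[M]_x f x).
  by apply: eq_measure_integral => A mA _; exact: leb_affine.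
rewrite ge0_integral_mscale//; congr (_ * _).
by rewrite (ge0_integral_pushforward mphi).
Qed.

Lemma integral_opp (f : R -> \bar R) :
  measurable_fun [set: R] f -> (forall x, 0 <= f x) ->
  \int[leb]_x f x = \int[leb]_x f (- x)%R.
Proof.
move=> mf f0.
have mphi : measurable_fun [set: R] (fun x : R => - x)%R by exact: measurableT_comp.
pose P : {measure set R -> \bar R} :=
  measure_function_pushforward__canonical__measure_function_Measure leb mphi.
transitivity (\int[P]_x f x); last by rewrite (ge0_integral_pushforward mphi).
by apply: eq_measure_integral => A mA _; exact/esym/lebesgue_measureN.
Qed.

Lemma integral_affine (f : R -> \bar R) (c d : R) : c != 0%R ->
  measurable_fun [set: R] f -> (forall x, 0 <= f x) ->
  \int[leb]_x f x = `|c|%:E * \int[leb]_x f (c * x + d)%R.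
Proof.
move=> c0 mf f0; have [cp|cn] := ltP 0%R c.
  by rewrite gtr0_norm//; exact: integral_affine_pos.
have {}cn : (0 < - c)%R by rewrite oppr_gt0 lt_neqAle c0.
rewrite ler0_norm; last by rewrite -oppr_ge0 ltW.
have mphi : measurable_fun [set: R] (fun x : R => c * x + d)%R.
  by apply: measurable_funD => //; exact: measurable_funM.
rewrite (integral_affine_pos d cn)// [in RHS]integral_opp//.
  by under [in RHS]eq_integral do rewrite mulrN -mulNr.
exact: measurableT_comp.
Qed.

End affine.

(** * Brunn-Minkowski and Prekopa-Leindler on the line *)

Section poweR_extra.
Context {R : realType}.
Local Open Scope ereal_scope.
Implicit Types (x y z : \bar R) (r : R).

Lemma le_poweR x y r : (0 <= r)%R -> 0 <= x -> x <= y -> x `^ r <= y `^ r.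
Proof.
move=> r0 x0 xy; apply: gt0_ler_poweR => //; rewrite in_itv/= leey andbT //.
exact: le_trans xy.
Qed.

(** Continuity of the power from below, tested on positive reals only, so that [x] may be
    infinite. *)
Lemma poweR_le_lim x z r : (0 < r)%R -> 0 <= x -> 0 <= z ->
  (forall a : R, (0 < a)%R -> a%:E < x -> a%:E `^ r <= z) -> x `^ r <= z.
Proof.
move=> r0 x0; case: z => [z z0 H|_ _|//]; last by rewrite leey.
rewrite lee_fin in z0; rewrite leNgt; apply/negP => zx.
(* The real whose r-th power is [z]. If the claim failed, c < x, and any real strictly between them
   would contradict [H]. *)
pose c := (z `^ r^-1)%R.
have c0 : (0 <= c)%R by exact: powR_ge0.
have cr : (c `^ r = z)%R by rewrite -powRrM mulVf ?gt_eqF// powRr1.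
have cx : c%:E < x.
  rewrite ltNge; apply/negP => /(le_poweR (ltW r0) x0).
  by rewrite poweR_EFin cr leNgt zx.
have [a ca ax] : exists2 a : R, (c < a)%R & a%:E < x.
  case: x cx {x0 zx H} => [x||]//.
    rewrite lte_fin => cx; exists ((c + x) / 2)%R; rewrite ?lte_fin; lra.
  by move=> _; exists (c + 1)%R; rewrite ?ltry//; lra.
have := H a (le_lt_trans c0 ca) ax.
rewrite poweR_EFin lee_fin leNgt -{1}cr gt0_ltr_powR// nnegrE//.
by rewrite (le_trans c0)// ltW.
Qed.

Lemma poweRM_le_lim x y z r s : (0 < r)%R -> (0 < s)%R -> 0 <= x -> 0 <= y ->
  0 <= z ->
  (forall a b : R, (0 < a)%R -> (0 < b)%R -> a%:E < x -> b%:E < y ->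
    a%:E `^ r * b%:E `^ s <= z) ->
  x `^ r * y `^ s <= z.
Proof.
move=> r0 s0 x0 y0 z0 H.
have H1 a : (0 < a)%R -> a%:E < x -> a%:E `^ r * y `^ s <= z.
  move=> a0 ax; rewrite poweR_EFin -lee_pdivlMl ?powR_gt0//.
  apply: poweR_le_lim => //; first by rewrite mule_ge0// lee_fin invr_ge0 powR_ge0.
  by move=> b b0 bz; rewrite lee_pdivlMl ?powR_gt0// -poweR_EFin; exact: H.
have : 0 <= y `^ s by exact: poweR_ge0.
move: (y `^ s) H1 => w H1; rewrite le_eqVlt => /predU1P[<-|]; first by rewrite mule0.
(* When the second power is infinite, x = 0 gives 0 by the convention 0 * +oo = 0; otherwise a
   positive real below [x] forces z = +oo. *)
case: w H1 => [w||]// H1 w0; last first.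
  move: x0; rewrite le_eqVlt => /predU1P[<-|x0].
    by rewrite poweR0r ?gt_eqF// mul0e.
  have [a a0 ax] : exists2 a : R, (0 < a)%R & a%:E < x.
    case: x x0 {H H1} => [x||]//.
      by rewrite lte_fin => x0; exists (x / 2)%R; rewrite ?lte_fin; lra.
    by move=> _; exists 1%R; rewrite ?ltry.
  have := H1 _ a0 ax; rewrite gt0_muley ?poweR_gt0 ?lte_fin// leye_eq => /eqP ->.
  by rewrite leey.
rewrite muleC -lee_pdivlMl//; apply: poweR_le_lim => //.
  by rewrite mule_ge0// lee_fin invr_ge0 ltW.
by move=> a a0 ax; rewrite lee_pdivlMl// muleC; exact: H1.
Qed.

(** Weighted arithmetic-geometric mean for u / l and v / (1 - l), obtained from Young's inequality
    with exponents 1/l and 1/(1 - l). The factor is the constant of Prekopa-Leindler in sum form. *)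
Lemma wAGM (u v l : R) : (0 < l < 1)%R -> (0 <= u)%R -> (0 <= v)%R ->
  (u `^ l * v `^ (1 - l) <= (l `^ l * (1 - l) `^ (1 - l)) * (u + v))%R.
Proof.
move=> /andP[l0 l1] u0 v0.
have k0 : (0 < 1 - l)%R by rewrite subr_gt0.
pose a := ((u / l) `^ l)%R; pose b := ((v / (1 - l)) `^ (1 - l))%R.
have := @conjugate_powR R a b l^-1%R (1 - l)^-1%R (powR_ge0 _ _) (powR_ge0 _ _).
rewrite !invr_gt0 l0 k0 !invrK subrKC => /(_ erefl erefl erefl).
have ul0 : (0 <= u / l)%R by rewrite divr_ge0// ltW.
have vl0 : (0 <= v / (1 - l))%R by rewrite divr_ge0// ltW.
rewrite -!powRrM !divff ?gt_eqF// !powRr1// !divfK ?gt_eqF// => ab.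
have -> : (u = l * (u / l))%R by rewrite mulrC divfK// gt_eqF.
have -> : (v = (1 - l) * (v / (1 - l)))%R by rewrite mulrC divfK// gt_eqF.
rewrite (powRM _ (ltW l0) ul0) (powRM _ (ltW k0) vl0) mulrACA ler_wpM2l//.
  by rewrite mulr_ge0// powR_ge0.
by rewrite [X in (_ <= X + _)%R]mulrC [X in (_ <= _ + X)%R]mulrC !divfK ?gt_eqF.
Qed.

End poweR_extra.

Section brunn_minkowski.
Context {R : realType}.
Local Open Scope ereal_scope.

Lemma leb_translate (A : set R) (d : R) : measurable A ->
  leb A = leb [set x | A (x + d)%R].
Proof.
move=> mA; rewrite (leb_affine d (@ltr01 R))// mul1e.
by congr (leb _); apply/funext => x /=; rewrite mul1r.
Qed.

Lemma measurable_translate (A : set R) (d : R) : measurable A ->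
  measurable [set x | A (x + d)%R].
Proof.
have m : measurable_fun [set: R] (fun x : R => x + d)%R by exact: measurable_funD.
by move=> mA; have := m measurableT A mA; rewrite setTI.
Qed.

(** Choose a in A within e/2 of sup A and b in B within e/2 of inf B. The part of A left of a,
    shifted by b, and the part of B right of b, shifted by a, both lie in C, on opposite sides of a
    + b; hence they are disjoint. The discarded parts fit in intervals of length e/2. *)
Lemma brunn_minkowski1 (A B C : set R) (M : R) :
  measurable A -> measurable B -> measurable C ->
  A !=set0 -> B !=set0 ->
  A `<=` `[(- M)%R, M]%classic -> B `<=` `[(- M)%R, M]%classic ->
  (forall a b, A a -> B b -> C (a + b)%R) ->
  leb A + leb B <= leb C.
Proof.
move=> mA mB mC A0 B0 AM BM ABC; apply/lee_addgt0Pr => e e0.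
have e20 : (0 < e / 2)%R by rewrite divr_gt0.
have hsA : has_sup A.
  by split => //; exists M => x /AM; rewrite /= in_itv/= => /andP[].
have hiB : has_inf B.
  by split => //; exists (- M)%R => x /BM; rewrite /= in_itv/= => /andP[].
have [a Aa sa] := sup_adherent e20 hsA.
have [b Bb sb] := inf_adherent e20 hiB.
pose A' := A `&` `]-oo, a[%classic; pose B' := B `&` `[b, +oo[%classic.
have mA' : measurable A' by exact: measurableI.
have mB' : measurable B' by exact: measurableI.
have leA : leb A <= leb A' + (e / 2)%:E.
  have -> : (e / 2)%:E = leb `[a, (a + e / 2)%R]%classic.
    by rewrite [RHS]leb_itv/= lte_fin ltrDl e20 -EFinB addrAC subrr add0r.
  apply: (le_trans _ (measureU2 leb _ _)) => //.
  apply: le_measure; rewrite ?inE//; first exact: measurableU.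
  move=> x Ax; have [xa|ax] := ltP x a; first by left; split => //=; rewrite in_itv.
  right; rewrite /= in_itv/= ax/=.
  have := ub_le_sup (proj2 hsA) Ax; lra.
have leB : leb B <= leb B' + (e / 2)%:E.
  have -> : (e / 2)%:E = leb `[(b - e / 2)%R, b]%classic.
    rewrite [RHS]leb_itv/= lte_fin ifT; last lra.
    by rewrite -EFinB opprB addrCA subrr addr0.
  apply: (le_trans _ (measureU2 leb _ _)) => //.
  apply: le_measure; rewrite ?inE//; first exact: measurableU.
  move=> x Bx; have [xb|bx] := leP b x.
    by left; split => //=; rewrite in_itv/= xb.
  right; rewrite /= in_itv/= (ltW bx) andbT.
  have := ge_inf (proj2 hiB) Bx; lra.
have : leb A' + leb B' <= leb C.
  rewrite (leb_translate (- b) mA') (leb_translate (- a) mB').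
  rewrite -measureU; [|exact: measurable_translate..|].
    apply: le_measure; rewrite ?inE//.
      by apply: measurableU; exact: measurable_translate.
    move=> x /= [[Ax _]|[Bx _]].
    - by rewrite -(subrK b x); exact: ABC.
    - by rewrite -(subrKC a x); exact: ABC.
  rewrite -subset0 => x /= [[_ +] [_ +]]; rewrite /= !in_itv/= andbT; lra.
move=> H; apply: (@le_trans _ _ ((leb A' + (e / 2)%:E) + (leb B' + (e / 2)%:E))).
  exact: leeD.
by rewrite addeACA -EFinD -splitr leeD2r.
Qed.

End brunn_minkowski.

Section prekopa_leindler1.
Context {R : realType}.
Local Open Scope ereal_scope.

Lemma measurable_superlevel {d} {T : measurableType d}
    (mu : {sigma_finite_measure set T -> \bar R}) (f : T -> \bar R) :
  measurable_fun [set: T] f ->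
  measurable_fun [set: R] (fun t => mu [set x | t%:E < f x]).
Proof.
move=> mf.
have mP : measurable_fun [set: T * R] (fun p : T * R => p.2%:E < f p.1).
  apply: measurable_fun_lte; first by apply/measurable_EFinP.
  exact: measurableT_comp.
have := @measurable_fun_fubini_tonelli_G _ _ _ _ _ mu
  (fun p : T * R => ebool (p.2%:E < f p.1)).
move=> /(_ _ (fun=> ebool_ge0 _)) H.
have := H (measurable_ebool mP); apply: eq_measurable_fun => t _.
rewrite /fubini_G (integral_ebool _ (f := fun x => t%:E < f x))//.
by apply: measurable_fun_lte.
Qed.

(** Since both suprema are 1, the superlevel sets of f and g at a level t < 1 are both nonempty, so
    Brunn-Minkowski applies to them; at levels t >= 1 both are empty. The layer cake formula then
    sums over the levels. *)
Lemma prekopa_leindler_normalized (f g h : R -> \bar R) (M : R) :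
  measurable_fun [set: R] f -> measurable_fun [set: R] g ->
  measurable_fun [set: R] h ->
  (forall x, 0 <= f x <= 1) -> (forall x, 0 <= g x <= 1) ->
  (forall x, 0 <= h x) ->
  (forall x, 0 < f x -> x \in `[(- M)%R, M]) ->
  (forall x, 0 < g x -> x \in `[(- M)%R, M]) ->
  (forall t : R, (t < 1)%R -> exists x, t%:E < f x) ->
  (forall t : R, (t < 1)%R -> exists x, t%:E < g x) ->
  (forall x y, mine (f x) (g y) <= h (x + y)%R) ->
  \int[leb]_x f x + \int[leb]_x g x <= \int[leb]_x h x.
Proof.
move=> mf mg mh f01 g01 h0 fM gM f1 g1 fgh.
have f0 x : 0 <= f x by have /andP[] := f01 x.
have g0 x : 0 <= g x by have /andP[] := g01 x.
have ms (k : R -> \bar R) : measurable_fun [set: R] k -> measurable_fun [set: R]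
    (fun t => ebool (0 < t)%R * leb [set x | t%:E < k x]).
  move=> mk; apply: emeasurable_funM; last exact: measurable_superlevel.
  by apply: measurable_ebool; exact: measurable_fun_ltr.
have mset (k : R -> \bar R) (t : R) : measurable_fun [set: R] k ->
    measurable [set x | t%:E < k x].
  by move=> mk; apply: (measurable_bool_set (f := fun x => t%:E < k x));
    exact: measurable_fun_lte.
rewrite (layer_cake leb mf f0) (layer_cake leb mg g0) (layer_cake leb mh h0).
rewrite -ge0_integralD//; [|by move=> t _; rewrite mule_ge0// ebool_ge0|exact: ms
  |by move=> t _; rewrite mule_ge0// ebool_ge0|exact: ms].
apply: ge0_le_integral => //.
- by move=> t _; rewrite adde_ge0// mule_ge0// ebool_ge0.
- by apply: emeasurable_funD; exact: ms.
- exact: ms.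
move=> t _; have [t0|_] := ltP 0%R t; last by rewrite /ebool !mul0e adde0.
rewrite /ebool !mul1e; have [t1|t1] := ltP t 1%R; last first.
  have empty (k : R -> \bar R) : (forall x, 0 <= k x <= 1) ->
      [set x | t%:E < k x] = set0.
    move=> k01; rewrite -subset0 => x /=; have /andP[_ k1] := k01 x.
    by rewrite ltNge (le_trans k1).
  by rewrite (empty f)// (empty g)//
    !(measure0 leb) adde0 measure_ge0.
apply: (brunn_minkowski1 (M := M)) => //; try exact: mset.
- by have [x] := f1 t t1; exists x.
- by have [x] := g1 t t1; exists x.
- by move=> x /= tx; apply: fM; rewrite (le_lt_trans _ tx)// lee_fin ltW.
- by move=> x /= tx; apply: gM; rewrite (le_lt_trans _ tx)// lee_fin ltW.
- move=> a b /= ta tb; apply: lt_le_trans (fgh a b).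
  by rewrite lt_min ta.
Qed.

(** Finiteness allows the two integrals to be treated as reals when [wAGM] is applied. *)
Lemma integral_unit_bounded (f : R -> \bar R) (M : R) :
  measurable_fun [set: R] f -> (forall x, 0 <= f x <= 1) ->
  (forall x, 0 < f x -> x \in `[(- M)%R, M]) ->
  \int[leb]_x f x < +oo.
Proof.
move=> mf f01 fM.
apply: (@le_lt_trans _ _ (\int[leb]_x ebool (x \in `[(- M)%R, M]))).
  apply: ge0_le_integral => //.
  - by move=> x _; have /andP[] := f01 x.
  - apply: measurable_ebool.
    rewrite (_ : (fun x => _) = fun x => (- M <= x)%R && (x <= M)%R).
      by apply: measurable_and; exact: measurable_fun_ler.
    by apply/funext => x; rewrite in_itv.
  - move=> x _; have /andP[+ f1] := f01 x.
    by rewrite le_eqVlt => /predU1P[<-|/fM ->//]; exact: ebool_ge0.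
rewrite (integral_ebool leb (f := fun x => x \in `[(- M)%R, M])).
  rewrite (_ : [set x | _] = `[(- M)%R, M]%classic)//.
  by rewrite [ltLHS]leb_itv/=; case: ifPn; rewrite ?ltry.
rewrite (_ : (fun x => _) = fun x => (- M <= x)%R && (x <= M)%R).
  by apply: measurable_and; exact: measurable_fun_ler.
by apply/funext => x; rewrite in_itv.
Qed.

End prekopa_leindler1.

Section prekopa_leindler.
Context {R : realType}.
Local Open Scope ereal_scope.

(** The Jacobian cost of writing h(x + y) for h(l x + (1 - l) y): the variables of the two functions
    are dilated by l and 1 - l. *)
Definition pl_cst (l : R) : R := (l `^ l * (1 - l) `^ (1 - l))%R.

Lemma pl_cst_gt0 (l : R) : (0 < l < 1)%R -> (0 < pl_cst l)%R.
Proof. by move=> /andP[l0 l1]; rewrite mulr_gt0// powR_gt0// subr_gt0. Qed.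

(** Dividing F and G by their suprema a and b reduces to the normalized case, because a minimum is
    at most a geometric mean; H is divided by a^l b^(1 - l). The resulting sum of integrals is
    turned back into a product by [wAGM]. *)
Lemma prekopa_leindler_bounded (F G H : R -> \bar R) (l M : R) :
  (0 < l < 1)%R ->
  measurable_fun [set: R] F -> measurable_fun [set: R] G ->
  measurable_fun [set: R] H ->
  (forall x, 0 <= F x <= M%:E) -> (forall x, 0 <= G x <= M%:E) ->
  (forall x, 0 <= H x) ->
  (forall x, 0 < F x -> x \in `[(- M)%R, M]) ->
  (forall x, 0 < G x -> x \in `[(- M)%R, M]) ->
  (forall x y, F x `^ l * G y `^ (1 - l) <= H (x + y)%R) ->
  (\int[leb]_x F x) `^ l * (\int[leb]_x G x) `^ (1 - l) <=
  (pl_cst l)%:E * \int[leb]_x H x.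
Proof.
move=> l01 mF mG mH F0M G0M H0 FM GM FGH; have /andP[l0 l1] := l01.
have k0 : (0 < 1 - l)%R by rewrite subr_gt0.
have iH : 0 <= (pl_cst l)%:E * \int[leb]_x H x.
  by rewrite mule_ge0// ?integral_ge0// lee_fin ltW// pl_cst_gt0.
(* If the supremum is 0 the integral vanishes and so does the left side; otherwise the bound [M]
   makes the supremum a positive real by which to divide. *)
have scale (F' : R -> \bar R) : measurable_fun [set: R] F' ->
    (forall x, 0 <= F' x <= M%:E) -> (forall x, 0 < F' x -> x \in `[(- M)%R, M]) ->
    \int[leb]_x F' x = 0 \/ exists a : R, exists f : R -> \bar R,
    [/\ (0 < a)%R, measurable_fun [set: R] f, forall x, F' x = a%:E * f x,
        forall x, 0 <= f x <= 1 & forall t : R, (t < 1)%R -> exists x, t%:E < f x].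
  move=> mF' F0M' FM'.
  have sM : ereal_sup (range F') <= M%:E.
    by apply: ge_ereal_sup => _ [x _ <-]; have /andP[] := F0M' x.
  have s0 : 0 <= ereal_sup (range F').
    apply: (@le_trans _ _ (F' 0%R)); first by have /andP[] := F0M' 0%R.
    by apply: ereal_sup_ubound; exists 0%R.
  have Fs x : F' x <= ereal_sup (range F') by apply: ereal_sup_ubound; exists x.
  move: s0; rewrite le_eqVlt => /predU1P[s0|s0].
    left; apply: integral0_eq => x _; apply/eqP.
    by rewrite eq_le {1}s0 Fs; have /andP[] := F0M' x.
  right; move: (ereal_sup (range F')) sM s0 Fs
    (fun y => @ereal_sup_gt _ (range F') y) => [a||]// _ a0 Fa supF.
  rewrite lte_fin in a0.
  exists a, (fun x => a^-1%:E * F' x); split => //.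
  - exact: measurable_funeM.
  - by move=> x; rewrite muleA -EFinM divff ?gt_eqF// mul1e.
  - move=> x; have /andP[Fx0 _] := F0M' x.
    by rewrite mule_ge0 ?lee_fin ?invr_ge0 ?(ltW a0)//= lee_pdivrMl// mule1.
  - move=> t t1; have [|_ [x _ <-] tx] := supF (a * t)%:E.
      by rewrite lte_fin gtr_pMr.
    by exists x; rewrite lte_pdivlMl// -EFinM.
have [->|[a [f [a0 mf Faf f01 f1]]]] := scale F mF F0M FM.
  by rewrite poweR0r ?gt_eqF// mul0e.
have [->|[b [g [b0 mg Gbg g01 g1]]]] := scale G mG G0M GM.
  by rewrite (@poweR0r _ (1 - l)%R) ?gt_eqF// mule0.
have f0 x : 0 <= f x by have /andP[] := f01 x.
have g0 x : 0 <= g x by have /andP[] := g01 x.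
have fM x : 0 < f x -> x \in `[(- M)%R, M].
  by move=> fx; apply: FM; rewrite Faf mule_gt0.
have gM x : 0 < g x -> x \in `[(- M)%R, M].
  by move=> gx; apply: GM; rewrite Gbg mule_gt0.
pose c := (a `^ l * b `^ (1 - l))%R.
have c0 : (0 < c)%R by rewrite mulr_gt0// powR_gt0.
have abc (u v : \bar R) : 0 <= u -> 0 <= v ->
    (a%:E * u) `^ l * (b%:E * v) `^ (1 - l) = c%:E * (u `^ l * v `^ (1 - l)).
  move=> u0 v0; rewrite !poweRM ?lee_fin ?(ltW a0) ?(ltW b0)//.
  by rewrite !poweR_EFin /c EFinM muleACA.
have key : \int[leb]_x f x + \int[leb]_x g x <= \int[leb]_x (c^-1%:E * H x).
  apply: (prekopa_leindler_normalized (M := M)) => //.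
  - exact: measurable_funeM.
  - by move=> x; rewrite mule_ge0// lee_fin invr_ge0 ltW.
  move=> x y; rewrite lee_pdivlMl//; apply: le_trans (FGH x y).
  rewrite Faf Gbg abc// lee_pmul2l//.
  have fin1 (z : \bar R) : 0 <= z <= 1 -> exists2 r : R, z = r%:E & (0 <= r)%R.
    by case: z => [r||] /andP[]// r0 _; exists r.
  have [u -> u0] := fin1 _ (f01 x); have [v -> v0] := fin1 _ (g01 y).
  rewrite !poweR_EFin -EFinM.
  have minE w : (0 <= w -> w `^ l * w `^ (1 - l) = w)%R.
    move=> w0; rewrite -powRD ?subrKC ?powRr1//.
    by rewrite oner_eq0.
  rewrite -EFin_min lee_fin; have [uv|vu] := leP u v.
  - rewrite -[leLHS]minE// ler_wpM2l ?powR_ge0// ge0_ler_powR// ?nnegrE//.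
    exact: ltW.
  - rewrite -[leLHS]minE// ler_wpM2r ?powR_ge0// ge0_ler_powR// ?nnegrE ?ltW//.
have iE (a' : R) (f' : R -> \bar R) : (0 < a')%R -> measurable_fun [set: R] f' ->
    (forall x, 0 <= f' x) -> \int[leb]_x (a'%:E * f' x) = a'%:E * \int[leb]_x f' x.
  by move=> a'0 mf' f'0; rewrite ge0_integralZl// lee_fin ltW.
have -> : \int[leb]_x F x = \int[leb]_x (a%:E * f x).
  by apply: eq_integral => x _; exact: Faf.
have -> : \int[leb]_x G x = \int[leb]_x (b%:E * g x).
  by apply: eq_integral => x _; exact: Gbg.
rewrite !iE// abc ?integral_ge0//.
rewrite iE ?invr_gt0// in key.
have := integral_unit_bounded mf f01 fM; have := integral_unit_bounded mg g01 gM.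
move: key; have : 0 <= \int[leb]_x f x by exact: integral_ge0.
have : 0 <= \int[leb]_x g x by exact: integral_ge0.
case: (\int[leb]_x f x) => [u||]//; case: (\int[leb]_x g x) => [v||]// v0 u0 key _ _.
apply: (@le_trans _ _ (c%:E * ((pl_cst l)%:E * (u + v)%:E))).
  by rewrite lee_pmul2l// !poweR_EFin -!EFinM lee_fin wAGM.
rewrite muleCA lee_pmul2l//; last by rewrite lte_fin pl_cst_gt0.
by rewrite muleC -lee_pdivlMr// muleC.
Qed.

(** Height and support are cut at the same [m], so one constant serves as every bound in
    [prekopa_leindler_bounded]. *)
Definition trunc (F : R -> \bar R) (m : nat) (x : R) : \bar R :=
  mine (F x) m%:R%:E * ebool (x \in `[(- m%:R)%R, m%:R]).

Lemma measurable_trunc F m : measurable_fun [set: R] F ->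
  measurable_fun [set: R] (trunc F m).
Proof.
move=> mF; apply: emeasurable_funM; first exact: measurable_mine.
apply: measurable_ebool.
rewrite (_ : (fun x => _) = fun x => (- m%:R <= x)%R && (x <= m%:R)%R).
  by apply: measurable_and; exact: measurable_fun_ler.
by apply/funext => x; rewrite in_itv.
Qed.

Lemma trunc_ge0 F m x : (forall x, 0 <= F x) -> 0 <= trunc F m x.
Proof. by move=> F0; rewrite mule_ge0 ?ebool_ge0// le_min F0/= lee_fin. Qed.

Lemma trunc_le F m x : (forall x, 0 <= F x) -> trunc F m x <= F x.
Proof.
move=> F0; rewrite /trunc /ebool; case: (_ \in _).
  by rewrite mule1 ge_min lexx.
by rewrite mule0.
Qed.

Lemma trunc_homo F x : (forall x, 0 <= F x) ->
  {homo (trunc F)^~ x : m n / (m <= n)%N >-> m <= n}.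
Proof.
move=> F0 m n mn; rewrite /trunc.
have mnR : (m%:R <= n%:R :> R)%R by rewrite ler_nat.
rewrite {1}/ebool; case: (boolP (_ \in _)) => [xm|_] /=; last first.
  by rewrite mule0; exact: trunc_ge0.
have xn : x \in `[(- n%:R)%R, n%:R].
  by move: xm; rewrite !in_itv/= => /andP[? ?]; apply/andP; split; lra.
by rewrite /ebool xn !mule1 le_min !ge_min lexx/= lee_fin mnR orbT.
Qed.

Lemma trunc_lim F x : (forall x, 0 <= F x) -> limn ((trunc F)^~ x) = F x.
Proof.
move=> F0; rewrite (cvg_lim _ (ereal_nondecreasing_cvgn (trunc_homo x F0)))//.
apply/eqP; rewrite eq_le; apply/andP; split.
  by apply: ge_ereal_sup => _ [m _ <-]; exact: trunc_le.
have big (r : R) : exists m : nat, (r <= m%:R)%R /\ x \in `[(- m%:R)%R, m%:R].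
  exists (Num.truncn (`|r| + `|x|)).+1.
  have := truncnS_gt (`|r| + `|x|)%R; set m := _.+1%:R => rxm.
  have := ler_norm r; have := ler_norm x; have := ler_norm (- x).
  have := normr_ge0 r; have := normr_ge0 x.
  by rewrite normrN in_itv/=; split; [lra|apply/andP; split; lra].
have H (r : R) : r%:E <= F x -> r%:E <= ereal_sup (range ((trunc F)^~ x)).
  move=> rF; have [m [rm xm]] := big r.
  apply: (@le_trans _ _ (trunc F m x)).
    by rewrite /trunc /ebool xm mule1 le_min rF lee_fin.
  by apply: ereal_sup_ubound; exists m.
have := F0 x; case: (F x) H => [r||]// H _; first exact: H.
rewrite leye_eq; apply/eqP/eqyP => r r0; apply: H; exact: leey.
Qed.

(** Monotone convergence, stated for all large indices so that two functions can share a truncation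
    index. *)
Lemma integral_trunc F (a : R) : measurable_fun [set: R] F ->
  (forall x, 0 <= F x) -> a%:E < \int[leb]_x F x ->
  exists m, forall n, (m <= n)%N -> a%:E < \int[leb]_x trunc F n x.
Proof.
move=> mF F0 aF.
have nd : {homo (fun n => \int[leb]_x trunc F n x) : m n / (m <= n)%N >-> m <= n}.
  move=> m n mn; apply: ge0_le_integral => //.
  - by move=> x _; exact: trunc_ge0.
  - exact: measurable_trunc.
  - exact: measurable_trunc.
  - by move=> x _; exact: trunc_homo.
have E : \int[leb]_x F x = ereal_sup (range (fun n => \int[leb]_x trunc F n x)).
  rewrite -(cvg_lim _ (ereal_nondecreasing_cvgn nd))//.
  rewrite -(monotone_convergence leb measurableT (g' := trunc F)).
  - by apply: eq_integral => x _; rewrite trunc_lim.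
  - by move=> n; exact: measurable_trunc.
  - by move=> n x _; exact: trunc_ge0.
  - by move=> x _; exact: trunc_homo.
move: aF; rewrite E => /ereal_sup_gt[_ [m _ <-] am].
by exists m => n mn; rewrite (lt_le_trans am)// nd.
Qed.

(** By [poweRM_le_lim] it suffices to treat reals strictly below the two integrals. These stay below
    the integrals of the truncations at a common index, where the bounded case applies. *)
Lemma prekopa_leindler1 (F G H : R -> \bar R) (l : R) :
  (0 < l < 1)%R ->
  measurable_fun [set: R] F -> measurable_fun [set: R] G ->
  measurable_fun [set: R] H ->
  (forall x, 0 <= F x) -> (forall x, 0 <= G x) -> (forall x, 0 <= H x) ->
  (forall x y, F x `^ l * G y `^ (1 - l) <= H (x + y)%R) ->
  (\int[leb]_x F x) `^ l * (\int[leb]_x G x) `^ (1 - l) <=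
  (pl_cst l)%:E * \int[leb]_x H x.
Proof.
move=> l01 mF mG mH F0 G0 H0 FGH; have /andP[l0 l1] := l01.
have k0 : (0 < 1 - l)%R by rewrite subr_gt0.
apply: poweRM_le_lim; rewrite ?integral_ge0//.
  by rewrite mule_ge0// ?integral_ge0// lee_fin ltW// pl_cst_gt0.
move=> a b a0 b0 aF bG.
have [m Hm] := integral_trunc mF F0 aF; have [n Hn] := integral_trunc mG G0 bG.
have {}Hm := Hm _ (leq_maxl m n); have {}Hn := Hn _ (leq_maxr m n).
move: (maxn m n) Hm Hn => {n}m Fm Gm.
apply: (@le_trans _ _ ((\int[leb]_x trunc F m x) `^ l *
    (\int[leb]_x trunc G m x) `^ (1 - l))).
  by rewrite lee_pmul// ?poweR_ge0// le_poweR// ?lee_fin ?ltW.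
have tM (F' : R -> \bar R) : (forall x, 0 <= F' x) ->
    forall x, 0 <= trunc F' m x <= m%:R%:E.
  move=> F'0 x; rewrite trunc_ge0//= /trunc /ebool.
  by case: (_ \in _); rewrite ?mule1 ?mule0 ?lee_fin// ge_min lexx orbT.
have ts (F' : R -> \bar R) : forall x, 0 < trunc F' m x -> x \in `[(- m%:R)%R, m%:R].
  by move=> x; rewrite /trunc /ebool; case: (_ \in _) => //; rewrite mule0 ltxx.
apply: (prekopa_leindler_bounded (M := m%:R)) => //; try exact: measurable_trunc.
- exact: tM.
- exact: tM.
- exact: ts.
- exact: ts.
- move=> x y; apply: le_trans (FGH x y).
  by rewrite lee_pmul// ?poweR_ge0// le_poweR// ?trunc_ge0 ?trunc_le// ltW.
Qed.

End prekopa_leindler.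

(** * The one-dimensional Santalo inequality *)

Section exp_substitution.
Context {R : realType}.
Local Open Scope ereal_scope.

(** The measure e^a da. It is compared with [lnM], the image under [ln] of Lebesgue measure on the
    positive half-line; the two agree on half-open intervals, hence on all Borel sets. *)
Let expM (B : set R) : \bar R := \int[leb]_(a in B) (expR a)%:E.

Let expM0 : expM set0 = 0. Proof. by rewrite /expM integral_set0. Qed.

Let expM_ge0 B : 0 <= expM B.
Proof. by apply: integral_ge0 => a _; rewrite lee_fin expR_ge0. Qed.

Let measurable_EexpR (D : set R) : measurable_fun D (fun a : R => (expR a)%:E).
Proof.
apply: measurable_funTS; apply/measurable_EFinP.
exact: continuous_measurable_fun (@continuous_expR R).
Qed.

Let expM_sigma_additive : semi_sigma_additive expM.
Proof.
move=> A mA tA mUA; rewrite /expM ge0_integral_bigcup//.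
  by apply: is_cvg_ereal_nneg_natsum_cond => n _ _; exact: expM_ge0.
Qed.

HB.instance Definition _ := isMeasure.Build _ _ _ expM
  expM0 expM_ge0 expM_sigma_additive.

Let lnM (B : set R) : \bar R := leb [set u | (0 < u)%R /\ B (ln u)].

Let lnM0 : lnM set0 = 0.
Proof.
by rewrite /lnM (_ : [set u | _] = set0) ?(measure0 leb)// -subset0 => u [].
Qed.

Let lnM_ge0 B : 0 <= lnM B. Proof. exact: measure_ge0. Qed.

Let measurable_lnset (B : set R) : measurable B ->
  measurable [set u : R | (0 < u)%R /\ B (ln u)].
Proof.
move=> mB; have := @measurable_ln R measurableT B mB.
rewrite setTI => mlB; rewrite (_ : [set u | _] = `]0%R, +oo[%classic `&` @ln R @^-1` B).
  exact: measurableI.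
by apply/seteqP; split => u /=; rewrite in_itv/= andbT.
Qed.

Let lnM_sigma_additive : semi_sigma_additive lnM.
Proof.
move=> A mA tA mUA; rewrite /lnM.
rewrite (_ : [set u | _] = \bigcup_i [set u | (0 < u)%R /\ A i (ln u)]).
  apply: measure_semi_sigma_additive.
  - by move=> i; exact: measurable_lnset.
  - apply/trivIsetP => i j _ _ ij; rewrite -subset0 => u [[_ Ai] [_ Aj]].
    move/trivIsetP : tA => /(_ i j Logic.I Logic.I ij); rewrite -subset0.
    by move=> /(_ (ln u)); apply.
  - by apply: bigcup_measurable => i _; exact: measurable_lnset.
apply/seteqP; split => u /=; first by move=> [u0 [i _ Ai]]; exists i.
by move=> [i _ [u0 Ai]]; split => //; exists i.
Qed.

HB.instance Definition _ := isMeasure.Build _ _ _ lnM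
  lnM0 lnM_ge0 lnM_sigma_additive.

Let expM_itv (p q : R) : (p < q)%R ->
  expM `]p, q]%classic = (expR q - expR p)%:E.
Proof.
move=> pq; rewrite /expM integral_leb//.
rewrite integral_itv_obnd_cbnd// (continuous_FTC2 (F := expR))//.
- by apply: continuous_subspaceT; exact: continuous_expR.
- split => [x _| |].
  + exact: derivable_expR.
  + by apply: cvg_at_right_filter; exact: continuous_expR.
  + by apply: cvg_at_left_filter; exact: continuous_expR.
- by move=> x _; rewrite derive1E; exact: derive_val.
Qed.

Let lnM_itv (p q : R) : (p < q)%R ->
  lnM `]p, q]%classic = (expR q - expR p)%:E.
Proof.
move=> pq; rewrite /lnM (_ : [set u | (0 < u)%R /\ _] = `]expR p, expR q]%classic).
  by rewrite [LHS]leb_itv/= lte_fin ltr_expR pq.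
apply/seteqP; split => u /=; rewrite !in_itv/=.
- move=> [u0 /andP[pu uq]].
  have e : expR (ln u) = u by rewrite lnK ?posrE.
  by rewrite -e ltr_expR pu ler_expR.
- move=> /andP[pu uq]; have u0 : (0 < u)%R by rewrite (lt_trans _ pu)// expR_gt0.
  by split => //; rewrite -ltr_expR -ler_expR lnK ?posrE// pu uq.
Qed.

Lemma leb_pos_expR (A : set R) : measurable A ->
  leb [set u | (0 < u)%R /\ A u] = \int[leb]_(a in expR @^-1` A) (expR a)%:E.
Proof.
move=> mA.
have E : lnM (expR @^-1` A) = leb [set u | (0 < u)%R /\ A u].
  by congr (leb _); apply/seteqP; split => u /= [u0]; rewrite lnK ?posrE.
have ltk (k : nat) : (- k.+1%:R < k.+1%:R :> R)%R.
  by rewrite (@lt_trans _ _ 0%R)// ?oppr_lt0 ltr0n.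
rewrite -E; apply: (@measure_unique _ R R (@ocitv R)
  (fun k => `](- k.+1%:R)%R, k.+1%:R]%classic) erefl (@ocitvI R) _ _ lnM expM).
- by move=> k; exact: is_ocitv.
- apply/seteqP; split => // x _; exists (Num.truncn `|x|) => //=.
  have := truncnS_gt `|x|; have := ler_norm x; have := ler_norm (- x)%R.
  by rewrite normrN in_itv/= => ? ? ?; apply/andP; split; lra.
- move=> _ [[p q] _ <-]/=; have [pq|qp] := ltP p q.
    by rewrite [LHS]lnM_itv// [RHS]expM_itv.
  by rewrite set_itv_ge ?bnd_simp -?leNgt// [LHS]lnM0 [RHS]expM0.
- by move=> k; rewrite [ltLHS]lnM_itv// ltry.
- by have := continuous_measurable_fun (@continuous_expR R) measurableT mA; rewrite setTI.
Qed.

(** [leb_pos_expR] is the case of indicators; applied to every superlevel set of [f], it gives the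
    general case by the layer cake formula, with [f] merely measurable. *)
Lemma exp_substitution (f : R -> \bar R) : measurable_fun [set: R] f ->
  (forall u, 0 <= f u) ->
  \int[leb]_u (ebool (0 < u)%R * f u) = \int[leb]_a ((expR a)%:E * f (expR a)).
Proof.
move=> mf f0.
have mexp : measurable_fun [set: R] (@expR R).
  exact: continuous_measurable_fun (@continuous_expR R).
have mpos : measurable_fun [set: R] (fun u : R => ebool (0 < u)%R : \bar R).
  by apply: measurable_ebool; exact: measurable_fun_ltr.
rewrite layer_cake; last 2 first.
- exact: emeasurable_funM.
- by move=> u; rewrite mule_ge0// ebool_ge0.
transitivity (\int[leb]_t (ebool (0 < t)%R *
    \int[leb]_a ((expR a)%:E * ebool (t%:E < f (expR a))))).
  apply: eq_integral => t _; have [t0|t0] := ltP 0%R t; last by rewrite /ebool !mul0e.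
  congr (_ * _).
  have mA : measurable [set u | t%:E < f u].
    by apply: (measurable_bool_set (f := fun u => t%:E < f u)); exact: measurable_fun_lte.
  rewrite (_ : [set u | _] = [set u | (0 < u)%R /\ [set u | t%:E < f u] u]).
    rewrite [LHS](leb_pos_expR mA) integral_mkcond; apply: eq_integral => a _.
    rewrite patchE /ebool; case: (boolP (t%:E < f (expR a))) => ta.
      by rewrite mem_set// mule1.
    by rewrite memNset ?mule0//; exact/negP.
  apply/seteqP; split => u /=; rewrite /ebool.
    case: (ltP 0%R u) => u0; first by rewrite mul1e.
    by rewrite mul0e lte_fin ltNge (ltW t0).
  by move=> [-> tu]; rewrite mul1e.
rewrite -(tonelli_indicator leb (w := fun a => (expR a)%:E)
  (k := fun t => ebool (0 < t)%R) (P := fun p => p.2%:E < f (expR p.1)))//.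
- apply: eq_integral => a _; congr (_ * _).
  by rewrite /= integral_itv0.
- apply: measurable_fun_lte; first by apply/measurable_EFinP.
  by apply: measurableT_comp => //; exact: measurableT_comp.
- by move=> t; exact: ebool_ge0.
Qed.

End exp_substitution.

(** * Polar functions *)

Section polar.
Context {R : realType}.
Local Open Scope ereal_scope.

(* The infimum over [i] of [expR (- l i y) / c i], written as a supremum so as not
   to divide by extended reals. *)
Definition pol {I T : Type} (c : I -> \bar R) (l : I -> T -> R) (y : T) : \bar R :=
  ereal_sup [set z%:E | z in
    [set z : R | (0 <= z)%R /\ forall i, c i * z%:E <= (expR (- l i y))%:E]].

Section pol_theory.
Context {I T : Type} (c : I -> \bar R) (l : I -> T -> R).
Hypothesis c0 : forall i, 0 <= c i.

Lemma pol_ge0 y : 0 <= pol c l y.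
Proof.
by apply: ereal_sup_ubound; exists 0%R => //; split => // i; rewrite mule0 lee_fin expR_ge0.
Qed.

Lemma pol_le i y : c i * pol c l y <= (expR (- l i y))%:E.
Proof.
have := c0 i; rewrite le_eqVlt => /predU1P[<-|].
  by rewrite mul0e lee_fin expR_ge0.
case ci : (c i) => [r||]// r0.
- rewrite -lee_pdivlMl//; apply: ge_ereal_sup => _ [z [z0 zP] <-].
  by rewrite lee_pdivlMl// -ci.
(* An infinite weight admits only z = 0, so the polar vanishes here. *)
- suff -> : pol c l y = 0 by rewrite mule0 lee_fin expR_ge0.
  apply/eqP; rewrite eq_le pol_ge0 andbT.
  apply: ge_ereal_sup => _ [z [z0 zP] <-].
  have [->//|z1] := eqVneq z 0%R.
  have := zP i; rewrite ci mulyr gtr0_sg ?mul1e//.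
  by rewrite lt_neqAle eq_sym z1.
Qed.

(** The supremum ranges over real z only; an infinite z is reached through the positive reals. *)
Lemma le_pol y z : 0 <= z ->
  (forall i, c i * z <= (expR (- l i y))%:E) -> z <= pol c l y.
Proof.
have step (a : R) : (0 <= a)%R -> a%:E <= z ->
    (forall i, c i * z <= (expR (- l i y))%:E) -> a%:E <= pol c l y.
  move=> a0 az H; apply: ereal_sup_ubound; exists a => //; split => // i.
  by rewrite (le_trans _ (H i))// lee_wpmul2l.
move=> z0 H; case: z z0 step H => [z||]// z0 step H; first exact: step.
rewrite leye_eq; apply/eqP/eqyP => a a0; apply: step => //; first exact: ltW.
exact: leey.
Qed.

End pol_theory.

(** Rational levels make the union countable. Each member is an intersection over an arbitrary index
    type, so its measurability is a hypothesis; the uses below obtain it from closedness. *)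
Lemma measurable_pol {I} {d} {T : measurableType d} (c : I -> \bar R) (l : I -> T -> R) :
  (forall i, 0 <= c i) ->
  (forall z : R, measurable [set y | forall i, c i * z%:E <= (expR (- l i y))%:E]) ->
  measurable_fun [set: T] (pol c l).
Proof.
move=> c0 mS; apply: (measurability _ (ErealGenOInfty.measurableE R)).
move=> /= _ [_ [a ->]] <-; rewrite setTI.
have [a0|a0] := ltP a 0%R.
  rewrite (_ : _ @^-1` _ = setT)//; apply/seteqP; split => // y _ /=.
  by rewrite in_itv/= andbT (lt_le_trans _ (pol_ge0 c l y))// lte_fin.
rewrite (_ : _ @^-1` _ = \bigcup_(q : rat)
    (if (a < ratr q)%R then
      [set y | forall i, c i * (ratr q)%:E <= (expR (- l i y))%:E] else set0)).
  by apply: bigcupT_measurable_rat => q; case: ifPn.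
apply/seteqP; split => y /=; rewrite in_itv/= andbT.
- move=> /ereal_sup_gt[_ [z [z0 zP] <-]]; rewrite lte_fin => az.
  have [q] := rat_in_itvoo az; rewrite in_itv/= => /andP[aq qz].
  exists q => //; rewrite aq => i /=; apply: le_trans (zP i).
  by rewrite lee_wpmul2l// lee_fin ltW.
- move=> [q _]; case: ifPn => // aq H.
  apply: (@lt_le_trans _ _ (ratr q)%:E); first by rewrite lte_fin.
  by apply: le_pol => //; rewrite lee_fin (le_trans a0)// ltW.
Qed.

Lemma closed_pol_set {I} {T : topologicalType} (c : I -> \bar R) (l : I -> T -> R)
    (z : R) : (forall i, continuous (l i)) ->
  closed [set y | forall i, c i * z%:E <= (expR (- l i y))%:E].
Proof.
move=> cl; rewrite (_ : [set y | _] = \bigcap_i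
    [set y | c i * z%:E <= (expR (- l i y))%:E]).
  apply: closed_bigI => i _; case: (c i * z%:E) => [r||].
  - rewrite (_ : [set y | _] = (fun y => expR (- l i y)) @^-1` [set x | (r <= x)%R]).
      apply: preimage_closed; last exact: closed_ge.
      move=> y _; apply: continuous_comp; last exact: continuous_expR.
      by apply: continuousN; exact: cl.
    by apply/seteqP; split => y; rewrite /= lee_fin.
  - rewrite (_ : [set y | _] = set0); first exact: closed0.
    by rewrite -subset0 => y.
  - rewrite (_ : [set y | _] = setT); first exact: closedT.
    by apply/seteqP; split => y //= _; rewrite leNye.
by apply/seteqP; split => y /= H i; [move=> _|]; exact: H.
Qed.

End polar.

Section santalo_step.
Context {R : realType}.
Local Open Scope ereal_scope.

Lemma integral_even (f : R -> \bar R) : measurable_fun [set: R] f ->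
  (forall x, 0 <= f x) -> (forall x, f (- x)%R = f x) ->
  \int[leb]_x f x = 2%:E * \int[leb]_x (ebool (0 < x)%R * f x).
Proof.
move=> mf f0 fe.
have mg (b : R -> bool) : measurable_fun [set: R] b ->
    measurable_fun [set: R] (fun x => ebool (b x) * f x).
  by move=> mb; apply: emeasurable_funM => //; exact: measurable_ebool.
have mp : measurable_fun [set: R] (fun x => ebool (0 < x)%R * f x).
  by apply: mg; exact: measurable_fun_ltr.
have mn : measurable_fun [set: R] (fun x => ebool (x < 0)%R * f x).
  by apply: mg; exact: measurable_fun_ltr.
have me : measurable_fun [set: R] (fun x => ebool (x == 0)%R * f x).
  by apply: mg; exact: measurable_fun_eqr.
transitivity (\int[leb]_x (ebool (0 < x)%R * f x + ebool (x < 0)%R * f x +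
    ebool (x == 0)%R * f x)).
  apply: eq_integral => x _; rewrite /ebool.
  by case: (ltgtP x 0%R) => _; rewrite ?mul1e ?mul0e ?adde0 ?add0e.
rewrite ge0_integralD//; [|by move=> x _; rewrite adde_ge0 ?mule_ge0 ?ebool_ge0|exact: emeasurable_funD
  |by move=> x _; rewrite mule_ge0 ?ebool_ge0].
rewrite ge0_integralD//; [|by move=> x _; rewrite mule_ge0 ?ebool_ge0|by move=> x _; rewrite mule_ge0 ?ebool_ge0].
rewrite (_ : \int[leb]_x (ebool (x == 0)%R * f x) = 0); last first.
  transitivity (\int[leb]_(x in [set 0%R]) f x).
    rewrite [RHS]integral_mkcond; apply: eq_integral => x _; rewrite patchE /ebool.
    have [->|x0] := eqVneq x 0%R; first by rewrite mem_set// mul1e.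
    by rewrite memNset ?mul0e//=; apply/eqP.
  by rewrite integral_leb// ?integral_set1//; exact: measurable_funTS.
rewrite adde0 (_ : \int[leb]_x (ebool (x < 0)%R * f x) =
  \int[leb]_x (ebool (0 < x)%R * f x)).
  by rewrite (_ : 2%:E = 1 + 1)// ge0_muleDl// mul1e.
rewrite integral_opp//.
  by apply: eq_integral => x _; rewrite fe oppr_lt0.
by move=> x; rewrite mule_ge0 ?ebool_ge0.
Qed.

Lemma poweR_half (x : \bar R) : 0 <= x -> x `^ 2^-1 * x `^ 2^-1 = x.
Proof.
have h : (2^-1 + 2^-1 = 1 :> R)%R by lra.
move=> x0; rewrite -poweRD ?h ?poweRe1//.
by apply: add_neq0_poweRD_def; rewrite h oner_eq0.
Qed.

Lemma pl_cst_half : (pl_cst 2^-1 = 2^-1 :> R)%R.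
Proof.
have h : (1 - 2^-1 = 2^-1 :> R)%R by lra.
have hp : (0 < 2^-1 :> R)%R by lra.
have h2 : (2^-1 + 2^-1 = 1 :> R)%R by lra.
by rewrite /pl_cst h -powRD ?h2 ?powRr1 ?oner_eq0// ltW.
Qed.

Definition gauss1 : \bar R := \int[leb]_s (expR (- s ^+ 2)%R)%:E.

Lemma measurable_expR_comp {d} {T : measurableType d} (f : T -> R) :
  measurable_fun [set: T] f -> measurable_fun [set: T] (fun x => (expR (f x))%:E).
Proof.
move=> mf; apply/measurable_EFinP.
exact: (measurableT_comp (f := @expR R)).
Qed.

(* Substituting [c = 2 a + ln 2] turns the Prekopa-Leindler majorant into the
   Gaussian. *)
Lemma integral_majorant :
  \int[leb]_c (expR (2^-1 * (c - expR c)))%:E = (expR (2^-1 * ln 2))%:E * gauss1.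
Proof.
have mE : measurable_fun [set: R] (@expR R).
  exact: continuous_measurable_fun (@continuous_expR R).
have mf : measurable_fun [set: R] (fun c : R => (expR (2^-1 * (c - expR c)))%:E).
  by apply: measurable_expR_comp; apply: measurable_funM => //; exact: measurable_funB.
have mg : measurable_fun [set: R] (fun s : R => (expR (- s ^+ 2)%R)%:E).
  by apply: measurable_expR_comp; exact: measurableT_comp.
rewrite (integral_affine_pos (c := 2%R) (ln 2)) ?ltr0n//.
have -> : \int[leb]_(x in [set: R]) (expR (2^-1 * (2 * x + ln 2 - expR (2 * x + ln 2)))%R)%:E =
    \int[leb]_a ((expR (2^-1 * ln 2)%R)%:E *
      ((expR a)%:E * (expR (- expR a ^+ 2)%R)%:E)).
  apply: eq_integral => a _; rewrite -!EFinM -!expRD; congr (expR _)%:E.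
  rewrite expRD lnK ?posrE ?ltr0n// (_ : expR (2 * a) = expR a ^+ 2)%R.
    by field.
  by rewrite -expRM_natl.
rewrite ge0_integralZl//; last first.
  apply: emeasurable_funM; first exact/measurable_EFinP.
  apply: measurable_expR_comp; apply: measurableT_comp => //.
  exact: measurable_funX.
rewrite -(exp_substitution (f := fun s : R => (expR (- s ^+ 2)%R)%:E))//.
rewrite muleCA; congr (_ * _); apply/esym/integral_even => // x.
by rewrite sqrrN.
Qed.

(** With u = e^a and t = e^b, the product of the two integrands is at most C e^(c - e^c), c = a + b,
    a function of the sum alone. Prekopa-Leindler with exponent 1/2 applies, and its conclusion is
    squared. *)
Lemma santalo_positive (h g : R -> \bar R) (C : R) : (0 <= C)%R ->
  measurable_fun [set: R] h -> measurable_fun [set: R] g ->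
  (forall u, 0 <= h u) -> (forall t, 0 <= g t) ->
  (forall u t, h u * g t <= (C * expR (- (u * t)))%:E) ->
  (\int[leb]_u (ebool (0 < u)%R * h u)) * (\int[leb]_t (ebool (0 < t)%R * g t)) <=
  (C / 2)%:E * (gauss1 * gauss1).
Proof.
move=> C0 mh mg h0 g0 hg.
have mE : measurable_fun [set: R] (@expR R).
  exact: continuous_measurable_fun (@continuous_expR R).
have E0 a : 0 <= (expR a : R)%:E by rewrite lee_fin expR_ge0.
have G0 : 0 <= gauss1 by apply: integral_ge0.
rewrite !exp_substitution//.
set X := \int[leb]_a _; set Y := \int[leb]_a _.
have X0 : 0 <= X by apply: integral_ge0 => a _; rewrite mule_ge0.
have Y0 : 0 <= Y by apply: integral_ge0 => a _; rewrite mule_ge0.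
(* [q] collects the root of C and the root of 2 from [integral_majorant]. Squaring gives q^2 = 2 C,
   which with the square 1/4 of [pl_cst] makes C / 2. *)
pose q := (Num.sqrt C * expR (2^-1 * ln 2))%R.
have q2 : (q * q = C * 2)%R.
  rewrite /q mulrACA -expr2 sqr_sqrtr// -expRD -mulrDl.
  by rewrite (_ : 2^-1 + 2^-1 = 1)%R ?mul1r ?lnK ?posrE//; lra.
have half : (1 - 2^-1 = 2^-1 :> R)%R by lra.
have key : X `^ 2^-1 * Y `^ 2^-1 <= (2^-1)%:E * (q%:E * gauss1).
  have := @prekopa_leindler1 R (fun a => (expR a)%:E * h (expR a))
    (fun a => (expR a)%:E * g (expR a))
    (fun c => (Num.sqrt C)%:E * (expR (2^-1 * (c - expR c)))%:E) 2^-1.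
  rewrite half pl_cst_half => H.
  have -> : q%:E * gauss1 =
      \int[leb]_c ((Num.sqrt C)%:E * (expR (2^-1 * (c - expR c)))%:E).
    rewrite ge0_integralZl ?lee_fin ?sqrtr_ge0//; last first.
      apply: measurable_expR_comp; apply: measurable_funM => //.
      exact: measurable_funB.
    by rewrite integral_majorant muleA -EFinM.
  apply: H.
  - by apply/andP; split; lra.
  - apply: emeasurable_funM; first exact/measurable_EFinP.
    exact: measurableT_comp.
  - apply: emeasurable_funM; first exact/measurable_EFinP.
    exact: measurableT_comp.
  - apply: emeasurable_funM => //.
    apply: measurable_expR_comp; apply: measurable_funM => //.
    exact: measurable_funB.
  - by move=> a; rewrite mule_ge0.
  - by move=> a; rewrite mule_ge0.
  - by move=> a; rewrite mule_ge0// lee_fin sqrtr_ge0.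
  move=> a b; rewrite -poweRM ?mule_ge0//.
  apply: (@le_trans _ _ ((C * expR (a + b - expR (a + b))%R)%:E `^ 2^-1)).
    apply: le_poweR; rewrite ?mule_ge0 ?invr_ge0//.
    rewrite muleACA muleC.
    apply: (@le_trans _ _ ((C * expR (- (expR a * expR b)))%:E *
      ((expR a)%:E * (expR b)%:E))); first by rewrite lee_wpmul2r// mule_ge0.
    by rewrite -!EFinM lee_fin !expRD le_eqVlt; apply/orP; left; apply/eqP; ring.
  rewrite poweR_EFin powRM ?expR_ge0// powR12_sqrt// EFinM lee_wpmul2l//.
  by rewrite lee_fin -expRM mulrC.
have -> : X * Y = (X `^ 2^-1 * Y `^ 2^-1) * (X `^ 2^-1 * Y `^ 2^-1).
  by rewrite muleACA !poweR_half.
apply: (le_trans (lee_pmul _ _ key key)); rewrite ?mule_ge0 ?poweR_ge0//.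
rewrite muleACA [X in _ * X <= _]muleACA muleA -!EFinM q2 lee_wpmul2r//.
  exact: mule_ge0.
by rewrite lee_fin; lra.
Qed.

End santalo_step.

Section santalo_line.
Context {R : realType}.
Local Open Scope ereal_scope.

(** In the induction [f] is a fibre of an even function, which need not be even itself. The even
    function h(u) = inf_t C e^(-u t) / g(t) dominates the geometric mean of f(s) and f(r) at u = s -
    r, so Prekopa-Leindler for f and its reflection bounds the integral of f by half that of h.
    [santalo_positive] then handles h and g on the half-line. *)
Lemma santalo_line (f g : R -> \bar R) (C : R) : (0 < C)%R ->
  measurable_fun [set: R] f -> measurable_fun [set: R] g ->
  (forall s, 0 <= f s) -> (forall t, 0 <= g t) -> (forall t, g (- t)%R = g t) ->
  (forall s r t, f s `^ 2^-1 * f r `^ 2^-1 * g t <=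
    (C * expR (- ((s - r) * t))%R)%:E) ->
  (\int[leb]_s f s) * (\int[leb]_t g t) <= C%:E * (gauss1 * gauss1).
Proof.
move=> C0 mf mg f0 g0 ge fg.
pose c t := C^-1%:E * g t; pose l (t u : R) := (u * t)%R.
have c0 t : 0 <= c t by rewrite mule_ge0// lee_fin invr_ge0 ltW.
pose h := pol c l.
have h0 u : 0 <= h u by exact: pol_ge0.
have hg u t : h u * g t <= (C * expR (- (u * t)))%:E.
  have := @pol_le R R R c l c0 t u.
  by rewrite /c -muleA lee_pdivrMl// muleC EFinM.
have mh : measurable_fun [set: R] h.
  apply: measurable_pol => // z; apply: closed_measurable; apply: closed_pol_set.
  by move=> t u; apply: cvgM; [exact: cvg_id|exact: cvg_cst].
have he u : h (- u)%R = h u.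
  have le v : h (- v)%R <= h v.
    apply: le_pol => // t.
    have := @pol_le R R R c l c0 (- t)%R (- v)%R.
    by rewrite /c ge /l mulrNN.
  by apply/eqP; rewrite eq_le le/=; have := le (- u)%R; rewrite opprK.
have hP u z : 0 <= z -> (forall t, c t * z <= (expR (- l t u))%:E) -> z <= h u.
  exact: le_pol.
clearbody h.
have half : (1 - 2^-1 = 2^-1 :> R)%R by lra.
have fh : \int[leb]_s f s <= \int[leb]_u (ebool (0 < u)%R * h u).
  have PL : (\int[leb]_s f s) `^ 2^-1 * (\int[leb]_s f (- s)%R) `^ (1 - 2^-1)%R <=
      (pl_cst 2^-1%R)%:E * \int[leb]_u h u.
    apply: prekopa_leindler1 => //.
    - by apply/andP; split; lra.
    - exact: measurableT_comp.
    move=> s r; rewrite half; apply: hP; first by rewrite mule_ge0 ?poweR_ge0.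
    move=> t; rewrite /c -muleA lee_pdivrMl// muleC -EFinM.
    by have := fg s (- r)%R t; rewrite opprK.
  move: PL; rewrite half pl_cst_half -(integral_opp mf f0).
  rewrite poweR_half ?integral_ge0// (integral_even mh h0 he).
  by rewrite muleA -EFinM mulVf// mul1e.
have ih0 : 0 <= \int[leb]_u (ebool (0 < u)%R * h u).
  by apply: integral_ge0 => u _; rewrite mule_ge0 ?ebool_ge0.
have ig0 : 0 <= \int[leb]_u (ebool (0 < u)%R * g u).
  by apply: integral_ge0 => u _; rewrite mule_ge0 ?ebool_ge0.
apply: (@le_trans _ _ ((\int[leb]_u (ebool (0 < u)%R * h u)) *
    (2%:E * \int[leb]_t (ebool (0 < t)%R * g t)))).
  rewrite (integral_even mg g0 ge); apply: lee_pmul => //; last by rewrite mule_ge0.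
  exact: integral_ge0.
rewrite muleCA; have := santalo_positive (ltW C0) mh mg h0 g0 hg.
move=> /(lee_wpmul2l (x := 2%:E)) H; apply: (le_trans (H _)) => //.
by rewrite muleA -EFinM mulrC divfK.
Qed.

End santalo_line.

(** * Lebesgue measure on row vectors *)

Section rV_measure.
Context {R : realType}.
Local Open Scope ereal_scope.

Lemma integral_rV0 (f : 'rV[R]_0 -> \bar R) : measurable_fun setT f ->
  \int[lebesgue_rV 0]_x f x = f 0%R.
Proof.
move=> mf; transitivity (\int[\d_(0%R : 'rV[R]_0)]_x f x); first by [].
by rewrite integral_dirac// diracT mul1e.
Qed.

Lemma integral_rV_cons n (f : 'rV[R]_n.+1 -> \bar R) :
  measurable_fun setT f -> (forall x, 0 <= f x) ->
  \int[lebesgue_rV n.+1]_x f x =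
  \int[leb]_s \int[lebesgue_rV n]_x f (rV_cons (s, x)).
Proof.
move=> mf f0.
have mc : measurable_fun [set: measurableTypeR R * 'rV[R]_n] (@rV_cons R n).
  exact: measurable_rV_cons.
have mfc : measurable_fun [set: measurableTypeR R * 'rV[R]_n] (f \o @rV_cons R n).
  exact: (measurableT_comp mf).
transitivity (\int[(@lebesgue_measure R) \x (@lebesgue_rV R n)]_p (f \o @rV_cons R n) p).
  exact: (ge0_integral_pushforward mc (@lebesgue_measure R \x @lebesgue_rV R n)%E measurableT mf).
rewrite fubini_tonelli1//; last by move=> p; exact: f0.
rewrite integral_leb//.
- exact: (@measurable_fun_fubini_tonelli_F _ _ R _ _ (lebesgue_rV n)
    (fun p : R * 'rV[R]_n => f (rV_cons p)) mfc).
- by move=> x _; exact: integral_ge0.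
Qed.

Lemma measurable_cons2 n (f : 'rV[R]_n.+1 -> \bar R) :
  measurable_fun setT f ->
  measurable_fun [set: R * 'rV[R]_n] (fun p => f (rV_cons p)).
Proof. by move=> mf; apply: (measurableT_comp mf); exact: measurable_rV_cons. Qed.

Lemma measurable_slice n (f : 'rV[R]_n.+1 -> \bar R) s :
  measurable_fun setT f -> measurable_fun setT (fun x => f (rV_cons (s, x))).
Proof. by move=> /measurable_cons2 mf; exact: (measurableT_comp mf). Qed.

Lemma measurable_fiber n (f : 'rV[R]_n.+1 -> \bar R) x :
  measurable_fun setT f -> measurable_fun setT (fun s => f (rV_cons (s, x))).
Proof. by move=> /measurable_cons2 mf; exact: (measurableT_comp mf). Qed.

Lemma measurable_integral_slice n (f : 'rV[R]_n.+1 -> \bar R) :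
  measurable_fun setT f -> (forall x, 0 <= f x) ->
  measurable_fun [set: R] (fun s => \int[lebesgue_rV n]_x f (rV_cons (s, x))).
Proof.
move=> /measurable_cons2 mf f0.
exact: (@measurable_fun_fubini_tonelli_F _ _ _ _ _ (lebesgue_rV n) _ mf).
Qed.

Lemma measurable_integral_fiber n (f : 'rV[R]_n.+1 -> \bar R) :
  measurable_fun setT f -> (forall x, 0 <= f x) ->
  measurable_fun [set: 'rV[R]_n] (fun x => \int[leb]_s f (rV_cons (s, x))).
Proof.
move=> /measurable_cons2 mf f0.
exact: (@measurable_fun_fubini_tonelli_G _ _ _ _ _ leb _ mf).
Qed.

Lemma integral_rV_cons_swap n (f : 'rV[R]_n.+1 -> \bar R) :
  measurable_fun setT f -> (forall x, 0 <= f x) ->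
  \int[lebesgue_rV n.+1]_x f x =
  \int[lebesgue_rV n]_x \int[leb]_s f (rV_cons (s, x)).
Proof.
move=> mf f0; rewrite integral_rV_cons//.
exact: (fubini_tonelli _ (measurable_cons2 mf)).
Qed.

Lemma rV_consD n (s t : R) (x y : 'rV[R]_n) :
  (rV_cons (s, x) + rV_cons (t, y) = rV_cons (s + t, x + y))%R.
Proof.
apply/rowP => i; have [j ->|->] := unliftP ord0 i.
  by rewrite mxE !rV_consS mxE.
by rewrite mxE !rV_cons0.
Qed.

Lemma rV_consZ n (c s : R) (x : 'rV[R]_n) :
  (c *: rV_cons (s, x) = rV_cons (c * s, c *: x))%R.
Proof.
apply/rowP => i; have [j ->|->] := unliftP ord0 i.
  by rewrite mxE !rV_consS mxE.
by rewrite mxE !rV_cons0.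
Qed.

Lemma rV_consN n (s : R) (x : 'rV[R]_n) :
  (- rV_cons (s, x) = rV_cons (- s, - x))%R.
Proof. by rewrite -scaleN1r rV_consZ mulN1r scaleN1r. Qed.

Lemma dot_cons n (s t : R) (x y : 'rV[R]_n) :
  dot (rV_cons (s, x)) (rV_cons (t, y)) = (s * t + dot x y)%R.
Proof.
rewrite /dot big_ord_recl !rV_cons0; congr (_ + _)%R.
by apply: eq_bigr => i _; rewrite !rV_consS.
Qed.

Lemma measurable_scale_rV n (c : R) :
  measurable_fun [set: 'rV[R]_n] (fun x : 'rV[R]_n => c *: x)%R.
Proof.
apply: measurable_fun_coordP => i; under eq_fun do rewrite mxE.
by apply: measurable_funM => //; exact: measurable_coord.
Qed.

Lemma integral_scale_rV n (f : 'rV[R]_n -> \bar R) (c : R) : c != 0%R ->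
  measurable_fun setT f -> (forall x, 0 <= f x) ->
  \int[lebesgue_rV n]_x f x =
  (`|c| ^+ n)%:E * \int[lebesgue_rV n]_x f (c *: x)%R.
Proof.
move=> c0; elim: n f => [|n IH] f mf f0.
  rewrite !integral_rV0 ?scaler0 ?expr0 ?mul1e//.
  by apply: (measurableT_comp mf); exact: measurable_scale_rV.
have mfc : measurable_fun setT (fun x : 'rV[R]_n.+1 => f (c *: x)%R).
  by apply: (measurableT_comp mf); exact: measurable_scale_rV.
rewrite !integral_rV_cons//.
rewrite (integral_affine 0 c0 (measurable_integral_slice mf f0)); last first.
  by move=> s; exact: integral_ge0.
rewrite exprS EFinM -muleA; congr (_ * _).
transitivity (\int[leb]_s ((`|c| ^+ n)%:E *
    \int[lebesgue_rV n]_x f (c *: rV_cons (s, x))%R)).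
  apply: eq_integral => s _; rewrite addr0 IH//; last exact: measurable_slice.
  by congr (_ * _); apply: eq_integral => x _; rewrite rV_consZ.
rewrite ge0_integralZl//.
- exact: (measurable_integral_slice mfc).
- by move=> s _; exact: integral_ge0.
Qed.

Lemma integral_opp_rV n (f : 'rV[R]_n -> \bar R) :
  measurable_fun setT f -> (forall x, 0 <= f x) ->
  \int[lebesgue_rV n]_x f x = \int[lebesgue_rV n]_x f (- x)%R.
Proof.
move=> mf f0; rewrite (integral_scale_rV (c := -1)) ?oppr_eq0 ?oner_eq0//.
rewrite normrN normr1 expr1n mul1e.
by apply: eq_integral => x _; rewrite scaleN1r.
Qed.

Lemma lebesgue_rV_scale n (A : set 'rV[R]_n) (c : R) : (0 < c)%R -> measurable A ->
  lebesgue_rV n [set x | A (c^-1 *: x)%R] = (c ^+ n)%:E * lebesgue_rV n A.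
Proof.
move=> c0 mA.
have c1 : c^-1%R != 0%R by rewrite invr_eq0 gt_eqF.
have mS : measurable [set x | A (c^-1 *: x)%R].
  by have := @measurable_scale_rV n c^-1%R measurableT A mA; rewrite setTI.
have := @integral_scale_rV n (fun x => (\1_A x)%:E) c^-1%R c1.
rewrite integral_indic// setIT ger0_norm ?invr_ge0 ?(ltW c0)// => ->; last 2 first.
- by apply/measurable_EFinP; exact: measurable_indic.
- by move=> x; rewrite lee_fin.
rewrite muleA -EFinM exprVn divff ?expf_neq0 ?gt_eqF// mul1e.
have := integral_indic (lebesgue_rV n) measurableT mS.
by rewrite setIT => <-.
Qed.

End rV_measure.

(** * Topology and scalar product of row vectors *)

Section rV_topology.
Context {R : realType} {n : nat}.

Lemma nbhs_rV (x : 'rV[R]_n) (A : set 'rV[R]_n) : nbhs x A ->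
  exists2 e : R, 0 < e & forall y : 'rV[R]_n, (forall i, `|x ord0 i - y ord0 i| < e) -> A y.
Proof.
move=> /nbhs_ballP[e /= e0 xeA]; exists e => // y xy; apply: xeA.
by split => // i j; rewrite (ord1 i); exact: xy.
Qed.

Lemma rat_approx (x e : R) : 0 < e -> exists q : rat, `|x - ratr q| < e.
Proof.
move=> e0; have [|q] := @rat_in_itvoo R (x - e) (x + e); first lra.
rewrite in_itv/= => /andP[? ?]; exists q.
by rewrite distrC ltr_distlC; apply/andP; split; lra.
Qed.

(** The sigma-algebra is generated by the coordinates, so an open set is exhibited as a countable
    union of open cubes with rational centre and half-side 1/(k + 1). *)
Lemma open_measurable_rV (U : set 'rV[R]_n) : open U -> measurable U.
Proof.
move=> oU.
pose B (p : 'rV[rat]_n * nat) : set 'rV[R]_n :=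
  [set y | forall i, `|ratr (p.1 ord0 i) - y ord0 i| < p.2.+1%:R^-1].
have mB p : measurable (B p).
  rewrite (_ : B p = \bigcap_(i in [set: 'I_n])
      [set y : 'rV[R]_n | `|ratr (p.1 ord0 i) - y ord0 i| < p.2.+1%:R^-1]).
    apply: fin_bigcap_measurable; first exact: finite_finset.
    move=> i _; apply: (measurable_bool_set
      (f := fun y : 'rV[R]_n => `|ratr (p.1 ord0 i) - y ord0 i| < p.2.+1%:R^-1)).
    apply: measurable_fun_ltr => //; apply: measurableT_comp => //.
    by apply: measurable_funB => //; exact: measurable_coord.
  by apply/seteqP; split => y /= h i; [move=> _; exact: h|exact: h].
rewrite (_ : U = \bigcup_p (if `[< B p `<=` U >] then B p else set0)).
  by apply: countable_bigcupT_measurable => // p; case: ifPn.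
apply/seteqP; split => [x Ux|x [p _]]; last first.
  by case: ifPn => [/asboolP|]//; exact.
have [e e0 xeU] := nbhs_rV (open_nbhs_nbhs (conj oU Ux)).
(* Half of e, because a point of the cube is compared with x through the centre of the cube. *)
have [k ke] : exists k : nat, k.+1%:R^-1 < e / 2.
  exists (Num.truncn (e / 2)^-1); rewrite invf_plt ?posrE ?divr_gt0//.
  exact: truncnS_gt.
have k0 : 0 < k.+1%:R^-1 :> R by rewrite invr_gt0.
pose q : 'rV[rat]_n := \row_i xchoose (rat_approx (x ord0 i) k0).
have qP i : `|x ord0 i - ratr (q ord0 i)| < k.+1%:R^-1.
  by rewrite mxE; exact: (xchooseP (rat_approx (x ord0 i) k0)).
exists (q, k) => //; case: ifPn => [_ i|/asboolP]; first by rewrite distrC.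
case=> y By; apply: xeU => i.
have := By i; have := qP i => /= h1 h2.
rewrite (_ : x ord0 i - y ord0 i =
  (x ord0 i - ratr (q ord0 i)) + (ratr (q ord0 i) - y ord0 i)); last by ring.
rewrite (le_lt_trans (ler_normD _ _))// (splitr e).
by apply: ltrD; [exact: lt_trans h1 ke|exact: lt_trans h2 ke].
Qed.

Lemma closed_measurable_rV (A : set 'rV[R]_n) : closed A -> measurable A.
Proof.
move=> cA; rewrite -(setCK A); apply: measurableC; apply: open_measurable_rV.
exact: closed_openC.
Qed.

Lemma continuous_coord (i : 'I_n) : continuous (fun y : 'rV[R]_n => y ord0 i).
Proof. exact: coord_continuous. Qed.

Lemma continuous_dot (x : 'rV[R]_n) : continuous (dot x).
Proof.
rewrite /dot; apply: continuous_big => [|i _]; first exact: add_continuous.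
move=> y; exact: (cvgM (cvg_cst (x ord0 i)) (@continuous_coord i y)).
Qed.

Lemma dotC (x y : 'rV[R]_n) : dot x y = dot y x.
Proof. by apply: eq_bigr => i _; rewrite mulrC. Qed.

Lemma dotDl (x y z : 'rV[R]_n) : dot (x + y) z = dot x z + dot y z.
Proof. by rewrite -big_split; apply: eq_bigr => i _; rewrite mxE mulrDl. Qed.

Lemma dotZl c (x y : 'rV[R]_n) : dot (c *: x) y = c * dot x y.
Proof. by rewrite /dot mulr_sumr; apply: eq_bigr => i _; rewrite mxE mulrA. Qed.

Lemma dotNl (x y : 'rV[R]_n) : dot (- x) y = - dot x y.
Proof. by rewrite -scaleN1r dotZl mulN1r. Qed.

Lemma dotDr (x y z : 'rV[R]_n) : dot x (y + z) = dot x y + dot x z.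
Proof. by rewrite dotC dotDl !(dotC x). Qed.

Lemma dotZr c (x y : 'rV[R]_n) : dot x (c *: y) = c * dot x y.
Proof. by rewrite dotC dotZl dotC. Qed.

Lemma dotNr (x y : 'rV[R]_n) : dot x (- y) = - dot x y.
Proof. by rewrite dotC dotNl dotC. Qed.

Lemma measurable_dotxx : measurable_fun [set: 'rV[R]_n] (fun x => dot x x).
Proof.
apply: measurable_sum => i; apply: measurable_funM; exact: measurable_coord.
Qed.

Lemma dotxx_ge0 (x : 'rV[R]_n) : 0 <= dot x x.
Proof. by apply: sumr_ge0 => i _; rewrite -expr2 sqr_ge0. Qed.

Lemma dotxx_eq0 (x : 'rV[R]_n) : (dot x x == 0) = (x == 0).
Proof.
apply/eqP/eqP => [|->]; last by rewrite /dot big1// => i _; rewrite mxE mul0r.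
move=> /psumr_eq0P h; apply/rowP => i; rewrite mxE.
have /eqP := h (fun i _ => sqr_ge0 _) i erefl.
by rewrite mulf_eq0 orbb => /eqP.
Qed.

End rV_topology.

(** * The functional Blaschke-Santalo inequality *)

Section functional_santalo.
Context {R : realType}.
Local Open Scope ereal_scope.

Lemma prekopa_leindler n (F G H : 'rV[R]_n -> \bar R) (l : R) :
  (0 < l < 1)%R ->
  measurable_fun setT F -> measurable_fun setT G -> measurable_fun setT H ->
  (forall x, 0 <= F x) -> (forall x, 0 <= G x) -> (forall x, 0 <= H x) ->
  (forall x y, F x `^ l * G y `^ (1 - l) <= H (x + y)%R) ->
  (\int[lebesgue_rV n]_x F x) `^ l * (\int[lebesgue_rV n]_x G x) `^ (1 - l) <=
  (pl_cst l ^+ n)%:E * \int[lebesgue_rV n]_x H x.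
Proof.
move=> l01; elim: n F G H => [|n IH] F G H mF mG mH F0 G0 H0 FGH.
  rewrite !integral_rV0// expr0 mul1e.
  by have := FGH 0%R 0%R; rewrite addr0.
have k0 : (0 <= pl_cst l ^+ n)%R by rewrite exprn_ge0// ltW// pl_cst_gt0.
rewrite !integral_rV_cons//.
have mHs := measurable_integral_slice mH H0.
have iH0 s : 0 <= \int[lebesgue_rV n]_x H (rV_cons (s, x)) by exact: integral_ge0.
apply: (@le_trans _ _ ((pl_cst l)%:E * \int[leb]_s ((pl_cst l ^+ n)%:E *
    \int[lebesgue_rV n]_x H (rV_cons (s, x))))).
  apply: prekopa_leindler1 => //.
  - exact: measurable_integral_slice.
  - exact: measurable_integral_slice.
  - exact: emeasurable_funM.
  - by move=> s; exact: integral_ge0.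
  - by move=> s; exact: integral_ge0.
  - by move=> s; rewrite mule_ge0// lee_fin.
  move=> s t; apply: IH => //; try exact: measurable_slice.
  by move=> x y; rewrite -rV_consD.
by rewrite ge0_integralZl// muleA -EFinM -exprS.
Qed.

Lemma gauss1E : gauss1 = (Num.sqrt pi : R)%:E.
Proof.
rewrite -integralT_gauss /gauss1 integral_leb//.
by apply/measurable_EFinP; exact: measurable_gauss_fun.
Qed.

(** A general constant [C] is carried because the induction hypothesis is applied with C g1^2:
    integrating out one variable multiplies the constant by the one-dimensional bound. *)
Lemma functional_santalo n (f g : 'rV[R]_n -> \bar R) (C : R) :
  (0 < C)%R ->
  measurable_fun setT f -> measurable_fun setT g ->
  (forall x, 0 <= f x) -> (forall x, 0 <= g x) ->
  (forall x, f (- x)%R = f x) -> (forall x, g (- x)%R = g x) ->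
  (forall x y, f x * g y <= (C * expR (- (2 * dot x y))%R)%:E) ->
  (\int[lebesgue_rV n]_x f x) * (\int[lebesgue_rV n]_x g x) <=
  (C * (Num.sqrt pi ^+ n) ^+ 2)%:E.
Proof.
have Eg := gauss1E; have g10 : (0 < Num.sqrt pi :> R)%R by rewrite sqrtr_gt0 pi_gt0.
move: (Num.sqrt pi) Eg g10 => g1 Eg g10; elim: n f g C => [|n IH] f g C C0 mf mg f0 g0 fe ge fg.
  rewrite !integral_rV0//; have := fg 0%R 0%R.
  by rewrite /dot big_ord0 mulr0 oppr0 expR0 expr0 expr1n.
pose F x := \int[leb]_s f (rV_cons (s, x)).
(* The polar of this family is g2(t, w) = inf over s, r, x of C e^(-(s - r) t - 2 <x, w>) /
   sqrt(f(s, x) f(r, x)). It is the largest function for which [santalo_line] applies to all pairs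
   of fibres f(., x) and g2(., w). *)
pose I : Type := (R * R * 'rV[R]_n)%type.
pose c (i : I) := C^-1%:E *
  (f (rV_cons (i.1.1, i.2)) `^ 2^-1 * f (rV_cons (i.1.2, i.2)) `^ 2^-1).
pose l (i : I) (y : 'rV[R]_n.+1) := dot (rV_cons ((i.1.1 - i.1.2)%R, (2 *: i.2)%R)) y.
have Ci0 : (0 <= C^-1)%R by rewrite invr_ge0 ltW.
have c0 i : 0 <= c i by rewrite !mule_ge0 ?poweR_ge0// lee_fin.
have [g2 [mg2 g20 g2le leg2]] : exists g2 : 'rV[R]_n.+1 -> \bar R,
    [/\ measurable_fun setT g2, forall y, 0 <= g2 y,
      forall i y, c i * g2 y <= (expR (- l i y))%:E &
      forall y z, 0 <= z -> (forall i, c i * z <= (expR (- l i y))%:E) -> z <= g2 y].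
  exists (pol c l); split.
  - apply: measurable_pol => // z; apply: closed_measurable_rV.
    apply: closed_pol_set => i; exact: continuous_dot.
  - by move=> y; exact: pol_ge0.
  - by move=> i y; exact: pol_le.
  - by move=> y z; exact: le_pol.
(* Exchanging s and r changes the sign of s - r and preserves the weight [c]. *)
have g2t t w : g2 (rV_cons ((- t)%R, w)) = g2 (rV_cons (t, w)).
  have le t' : g2 (rV_cons ((- t')%R, w)) <= g2 (rV_cons (t', w)).
    apply: leg2 => // -[[s r] x].
    have := g2le (r, s, x) (rV_cons ((- t')%R, w)).
    by rewrite /c/= [X in _ * X * _]muleC /l/= !dot_cons mulrN -mulNr opprB.
  by apply/eqP; rewrite eq_le le/=; have := le (- t)%R; rewrite opprK.
have g2e y : g2 (- y)%R = g2 y.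
  have le y' : g2 (- y')%R <= g2 y'.
    apply: leg2 => // -[[s r] x].
    have := g2le ((- s)%R, (- r)%R, (- x)%R) (- y')%R.
    rewrite /c/= -!rV_consN !fe /l/=.
    by rewrite -opprD scalerN -rV_consN dotNl dotNr opprK.
  by apply/eqP; rewrite eq_le le/=; have := le (- y)%R; rewrite opprK.
pose G w := \int[leb]_t g2 (rV_cons (t, w)).
have Fle x w : F x * G w <= (C * g1 ^+ 2 * expR (- (2 * dot x w))%R)%:E.
  apply: (@le_trans _ _ ((C * expR (- (2 * dot x w))%R)%:E * (gauss1 * gauss1))).
    apply: santalo_line => //.
    - by rewrite mulr_gt0// expR_gt0.
    - exact: measurable_fiber.
    - exact: measurable_fiber.
    move=> s r t; have := g2le (s, r, x) (rV_cons (t, w)).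
    rewrite /c/= -muleA lee_pdivrMl// => h; apply: (le_trans h).
    by rewrite -EFinM lee_fin /l dot_cons/= dotZl -mulrA -expRD ler_pM2l// ler_expR; lra.
  by rewrite Eg -!EFinM lee_fin expr2 mulrAC.
(* Multiplying the bounds on f(s, x) g(t, y) and f(r, x) g(-t, z) and taking roots shows that
   sqrt(g(t, y) g(-t, z)) is at most g2(t, (y + z) / 2). In Prekopa-Leindler the factor 2^(-n)
   cancels the dilation by 1/2, and the two slices of [g] have equal integrals because [g] is
   even. *)
have Ele : \int[lebesgue_rV n.+1]_y g y <= \int[lebesgue_rV n.+1]_y g2 y.
  rewrite !integral_rV_cons//; apply: ge0_le_integral => //.
  - by move=> t _; exact: integral_ge0.
  - exact: measurable_integral_slice.
  - exact: measurable_integral_slice.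
  move=> t _.
  have half : (1 - 2^-1 = 2^-1 :> R)%R by lra.
  have mh : measurable_fun setT (fun w : 'rV[R]_n => g2 (rV_cons (t, w))).
    exact: measurable_slice.
  have PL : (\int[lebesgue_rV n]_w g (rV_cons (t, w))) `^ 2^-1 *
      (\int[lebesgue_rV n]_w g (rV_cons ((- t)%R, w))) `^ (1 - 2^-1)%R <=
      (pl_cst 2^-1%R ^+ n)%:E *
      \int[lebesgue_rV n]_v g2 (rV_cons (t, (2^-1 *: v)%R)).
    apply: prekopa_leindler => //; try exact: measurable_slice.
    - by apply/andP; split; lra.
    - by apply: (measurableT_comp mh); exact: measurable_scale_rV.
    move=> y z; rewrite half; apply: leg2; first by rewrite mule_ge0 ?poweR_ge0.
    move=> [[s r] x]; rewrite /c/= -muleA lee_pdivrMl// muleACA.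
    rewrite -(poweRM _ (f0 _) (g0 _)) -(poweRM _ (f0 (rV_cons (r, x))) (g0 _)).
    apply: (@le_trans _ _
      ((C * expR (- (2 * dot (rV_cons (s, x)) (rV_cons (t, y))))%R)%:E `^ 2^-1 *
      (C * expR (- (2 * dot (rV_cons (r, x)) (rV_cons ((- t)%R, z))))%R)%:E `^ 2^-1)).
      by rewrite lee_pmul ?poweR_ge0// le_poweR ?mule_ge0 ?invr_ge0//; exact: fg.
    have eR (u : R) : (expR u `^ 2^-1 = expR (u / 2))%R by rewrite -expRM.
    rewrite !poweR_EFin -EFinM -EFinM lee_fin !powRM ?expR_ge0 ?(ltW C0)//.
    rewrite !eR mulrACA powR12_sqrt ?(ltW C0)// -expr2 sqr_sqrtr ?(ltW C0)//.
    rewrite -expRD ler_pM2l// ler_expR /l/= !dot_cons dotZl dotZr dotDr.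
    by lra.
  move: PL; rewrite half pl_cst_half.
  have -> : \int[lebesgue_rV n]_w g (rV_cons ((- t)%R, w)) =
      \int[lebesgue_rV n]_w g (rV_cons (t, w)).
    rewrite integral_opp_rV//; last exact: measurable_slice.
    by apply: eq_integral => w _; rewrite -rV_consN ge.
  rewrite poweR_half; last exact: integral_ge0.
  have c2 : (2^-1 : R)%R != 0%R by rewrite invr_eq0.
  by rewrite [X in _ -> _ <= X](integral_scale_rV c2)// ger0_norm// invr_ge0.
apply: (le_trans (lee_wpmul2l _ Ele)); first exact: integral_ge0.
rewrite !integral_rV_cons_swap//.
have := IH F G (C * g1 ^+ 2)%R.
rewrite -[(C * g1 ^+ 2 * _)%R]mulrA -exprMn -exprS; apply => //.
- by rewrite mulr_gt0// exprn_gt0.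
- exact: measurable_integral_fiber.
- exact: measurable_integral_fiber.
- by move=> x; exact: integral_ge0.
- by move=> x; exact: integral_ge0.
- move=> x; rewrite /F integral_opp//; last exact: measurable_fiber.
  by apply: eq_integral => s _; rewrite -rV_consN fe.
(* Evenness of [g2] reverses both t and w; the symmetry [g2t] restores t. *)
- move=> w; apply: eq_integral => t _.
  by rewrite -g2e rV_consN opprK g2t.
Qed.

End functional_santalo.

(** * Blaschke-Santalo for sets *)

Section volume_product.
Context {R : realType}.
Local Open Scope ereal_scope.

(** The derivative of -e^(-r^2) on the positive half-line: its mass on [a, +oo[ is e^(-a^2), so
    mixing the dilates of the unit ball with this weight gives the Gaussian. *)
Definition kap (r : R) : \bar R :=
  ebool (0 < r)%R * (2 * r * expR (- r ^+ 2))%:E.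

Lemma kap_ge0 r : 0 <= kap r.
Proof.
rewrite /kap; have [r0|_] := ltP 0%R r; last by rewrite /ebool mul0e.
by rewrite mule_ge0 ?ebool_ge0// lee_fin !mulr_ge0 ?expR_ge0// ltW.
Qed.

Lemma measurable_kap : measurable_fun [set: R] kap.
Proof.
apply: emeasurable_funM.
  by apply: measurable_ebool; exact: measurable_fun_ltr.
apply/measurable_EFinP; apply: measurable_funM; first exact: measurable_funM.
exact: measurable_gauss_fun.
Qed.

Lemma integral_kap (a : R) : (0 <= a)%R ->
  \int[leb]_r (kap r * ebool (a <= r)%R) = (expR (- a ^+ 2)%R)%:E.
Proof.
move=> a0.
transitivity (\int[leb]_(r in `[a, +oo[) (2 * r * expR (- r ^+ 2))%:E).
  rewrite [RHS]integral_mkcond; apply: eq_integral => r _.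
  rewrite patchE /kap mem_setE in_itv/= andbT.
  case: (leP a r) => ar; last by rewrite /ebool mule0.
  rewrite /ebool mule1; case: (ltP 0%R r) => r0; first by rewrite mul1e.
  have -> : r = 0%R by apply/eqP; rewrite eq_le r0 (le_trans a0).
  by rewrite mulr0 mul0r mule0.
have mf : measurable_fun [set: R] (fun r : R => (2 * r * expR (- r ^+ 2))%:E).
  apply/measurable_EFinP; apply: measurable_funM; first exact: measurable_funM.
  exact: measurable_gauss_fun.
rewrite integral_leb//; last 2 first.
- exact: measurable_funTS.
- move=> r; rewrite inE/= in_itv/= andbT => ar.
  by rewrite lee_fin !mulr_ge0 ?expR_ge0// (le_trans a0).
have dF (r : R) : is_derive r 1%R (fun r : R => - expR (- r ^+ 2))%R
    (2 * r * expR (- r ^+ 2))%R.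
  apply: is_derive_eq.
  rewrite /GRing.scale/=; ring.
have cg : continuous (fun r : R => expR (- r ^+ 2)) := @continuous_gauss_fun R.
rewrite (@ge0_continuous_FTC2y _ _ (fun r => - expR (- r ^+ 2))%R a 0).
- by rewrite EFinN oppeK add0e.
- by move=> r ar; rewrite !mulr_ge0 ?expR_ge0// (le_trans a0).
- apply: continuous_subspaceT => r; apply: cvgM; last exact: cg.
  by apply: cvgM; [exact: cvg_cst|exact: cvg_id].
- by rewrite -oppr0; apply: cvgN; exact: cvg_gauss_fun.
- by move=> r _; exact: ex_derive.
- by apply: cvgN; apply/cvg_at_right_filter; exact: cg.
- by move=> r _; rewrite derive1E; exact: derive_val.
Qed.

(* The Gaussian layer decomposition of a set; for a symmetric convex body it is
   [exp (- ||x||_K ^ 2)]. *)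
Definition gauss_layers n (K : set 'rV[R]_n) (x : 'rV[R]_n) : \bar R :=
  \int[leb]_r (kap r * ebool `[< K (r^-1 *: x)%R >]).

Lemma measurable_asbool {d} {T : measurableType d} (A : set T) : measurable A ->
  measurable_fun [set: T] (fun x => `[< A x >]).
Proof.
move=> mA; apply: (@measurable_fun_bool _ _ _ _ true).
rewrite setTI (_ : _ @^-1` _ = A)//.
by apply/seteqP; split => x /=; [move=> /asboolP|move=> /asboolP ->].
Qed.

Lemma measurable_invr : measurable_fun [set: R] (fun r : R => r^-1)%R.
Proof.
(* The factor [(r != 0)%:R] matches the convention that the inverse of 0 is 0. *)
rewrite (_ : (fun r => _) = fun r : R => if (0 < r)%R then (r `^ (-1))%R else
    (- ((- r) `^ (-1)) * (r != 0)%:R)%R).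
  apply: measurable_fun_ifT; [exact: measurable_fun_ltr|exact: measurable_powR|].
    apply: measurable_funM.
      apply: measurableT_comp => //.
      exact: (measurableT_comp (measurable_powR (-1)) (@oppr_measurable R setT)).
    apply/measurable_EFinP; apply: (measurable_ebool (f := fun r : R => r != 0%R)).
    by apply: measurable_neg; exact: measurable_fun_eqr.
apply/funext => r; case: (ltgtP 0%R r) => [r0|r0|<-].
- by rewrite powR_inv1// ltW.
- by rewrite mulr1 powR_inv1 ?oppr_ge0 ?ltW// invrN opprK.
- by rewrite mulr0 invr0.
Qed.

Lemma measurable_dilate n (K : set 'rV[R]_n) : measurable K ->
  measurable_fun [set: 'rV[R]_n * R] (fun p => `[< K (p.2^-1 *: p.1)%R >]).
Proof.
move=> mK.
have m : measurable_fun [set: 'rV[R]_n * R] (fun p => p.2^-1 *: p.1 : 'rV[R]_n)%R.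
  apply: measurable_fun_coordP => i; under eq_fun do rewrite mxE.
  apply: measurable_funM; last first.
    by apply: (measurableT_comp (measurable_coord i)); exact: measurable_fst.
  by apply: (measurableT_comp measurable_invr); exact: measurable_snd.
exact: (measurableT_comp (measurable_asbool mK) m).
Qed.

Lemma gauss_layers_ge0 n (K : set 'rV[R]_n) x : 0 <= gauss_layers K x.
Proof. by apply: integral_ge0 => r _; rewrite mule_ge0 ?kap_ge0 ?ebool_ge0. Qed.

Lemma measurable_gauss_layers n (K : set 'rV[R]_n) : measurable K ->
  measurable_fun [set: 'rV[R]_n] (gauss_layers K).
Proof.
move=> mK.
have mP : measurable_fun [set: 'rV[R]_n * R]
    (fun p => kap p.2 * ebool `[< K (p.2^-1 *: p.1)%R >]).
  apply: emeasurable_funM; last by apply: measurable_ebool; exact: measurable_dilate.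
  by apply: (measurableT_comp measurable_kap); exact: measurable_snd.
apply: (@measurable_fun_fubini_tonelli_F _ _ _ _ _ leb _ mP) => p.
by rewrite mule_ge0 ?kap_ge0 ?ebool_ge0.
Qed.

(** The dilate r K has volume r^n |K|, so the factor in front depends on the dimension only and
    cancels when a set is compared with the unit ball. *)
Lemma integral_gauss_layers n (K : set 'rV[R]_n) : measurable K ->
  \int[lebesgue_rV n]_x gauss_layers K x =
  (\int[leb]_r (kap r * (r ^+ n)%:E)) * lebesgue_rV n K.
Proof.
move=> mK.
transitivity (\int[lebesgue_rV n]_x (1 * \int[leb]_r
    (kap r * ebool `[< K (r^-1 *: x)%R >]))).
  by apply: eq_integral => x _; rewrite mul1e.
rewrite (tonelli_indicator (lebesgue_rV n) (w := cst 1) (k := kap)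
  (P := fun p => `[< K (p.2^-1 *: p.1)%R >]))//.
- rewrite -ge0_integralZr//.
  + apply: eq_integral => r _.
    under [X in _ * X = _]eq_integral do rewrite mul1e.
    have [r0|r0] := ltP 0%R r; last by rewrite /kap ltNge r0 /ebool !mul0e.
    rewrite -[RHS]muleA; congr (_ * _); rewrite -[RHS](lebesgue_rV_scale r0 mK).
    rewrite (integral_ebool (lebesgue_rV n) (f := fun x => `[< K (r^-1 *: x)%R >])).
      by congr (lebesgue_rV n _); apply/seteqP; split => x /= /asboolP.
    have m := @measurable_scale_rV R n r^-1%R.
    exact: (measurableT_comp (measurable_asbool mK) m).
  + apply: emeasurable_funM; first exact: measurable_kap.
    by apply/measurable_EFinP; exact: exprn_measurable.
  + move=> r _; rewrite /kap; have [r0|_] := ltP 0%R r.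
      by rewrite !mule_ge0 ?ebool_ge0// lee_fin ?exprn_ge0 ?mulr_ge0 ?expR_ge0// ltW.
    by rewrite /ebool !mul0e.
- exact: measurable_kap.
- exact: measurable_dilate.
- by move=> r; exact: kap_ge0.
Qed.

Lemma gauss_layers_le n (K : set 'rV[R]_n) (x : 'rV[R]_n) (a : R) : (0 <= a)%R ->
  measurable K ->
  (forall r, (0 < r)%R -> K (r^-1 *: x)%R -> (a <= r)%R) ->
  gauss_layers K x <= (expR (- a ^+ 2)%R)%:E.
Proof.
move=> a0 mK aK; rewrite -integral_kap//; apply: ge0_le_integral => //.
- by move=> r _; rewrite mule_ge0 ?kap_ge0 ?ebool_ge0.
- apply: emeasurable_funM; first exact: measurable_kap.
  apply: measurable_ebool.
  have m : measurable_fun [set: R] (fun r : R => (x, r)) by exact: measurable_fun_pair.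
  exact: (measurableT_comp (measurable_dilate mK) m).
- apply: emeasurable_funM; first exact: measurable_kap.
  by apply: measurable_ebool; exact: measurable_fun_ler.
move=> r _; have [r0|r0] := ltP 0%R r; last by rewrite /kap ltNge r0 /ebool !mul0e.
rewrite lee_wpmul2l ?kap_ge0//; case: asboolP => Kr; last exact: ebool_ge0.
by rewrite (aK r r0 Kr).
Qed.

(** Let a and b be the infima of the r > 0 with x in r K, respectively y in r L. Then <x, y> <= a b,
    and the product of the layers is at most e^(-a^2 - b^2) <= e^(-2 a b). A point in no dilate has
    an empty set of layers and contributes 0. *)
Lemma gauss_layers_mul n (K L : set 'rV[R]_n) (x y : 'rV[R]_n) :
  measurable K -> measurable L ->
  (forall u v, K u -> L v -> (dot u v <= 1)%R) ->
  gauss_layers K x * gauss_layers L y <= (1 * expR (- (2 * dot x y))%R)%:E.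
Proof.
move=> mK mL KL.
have zero (M : set 'rV[R]_n) z : ~ (exists r : R, (0 < r)%R /\ M (r^-1 *: z)%R) ->
    gauss_layers M z = 0.
  move=> H; apply: integral0_eq => r _.
  have [r0|r0] := ltP 0%R r; last by rewrite /kap ltNge r0 /ebool !mul0e.
  by case: asboolP => Mr; [case: H; exists r|rewrite /ebool mule0].
have e0 : 0 <= (1 * expR (- (2 * dot x y))%R)%:E by rewrite lee_fin mul1r expR_ge0.
have [[r1 [r10 Kr1]]|/zero ->] := pselect (exists r : R, (0 < r)%R /\ K (r^-1 *: x)%R);
  last by rewrite mul0e.
have [[s1 [s10 Ls1]]|/zero ->] := pselect (exists r : R, (0 < r)%R /\ L (r^-1 *: y)%R);
  last by rewrite mule0.
pose A := [set r : R | (0 < r)%R /\ K (r^-1 *: x)%R].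
pose B := [set r : R | (0 < r)%R /\ L (r^-1 *: y)%R].
have prod r s : A r -> B s -> (dot x y <= r * s)%R.
  move=> [r0 Kr] [s0 Ls]; have := KL _ _ Kr Ls; rewrite dotZl dotZr mulrA -invfM.
  by rewrite mulrC ler_pdivrMr ?mulr_gt0// mul1r.
have lbA : has_inf A by split; [exists r1|exists 0%R => r [/ltW]].
have lbB : has_inf B by split; [exists s1|exists 0%R => r [/ltW]].
have a0 : (0 <= inf A)%R by apply: lb_le_inf; [exists r1|move=> r [/ltW]].
have b0 : (0 <= inf B)%R by apply: lb_le_inf; [exists s1|move=> r [/ltW]].
have prod1 s : B s -> (dot x y <= inf A * s)%R.
  move=> Bs; have s0 : (0 < s)%R by case: Bs.
  rewrite -ler_pdivrMr//; apply: lb_le_inf; first by exists r1.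
  by move=> r Ar; rewrite ler_pdivrMr//; exact: prod.
have prod2 : (dot x y <= inf A * inf B)%R.
  (* The infimum of A may be 0 and then cannot be divided by; in that case [prod1] already gives <x,
     y> <= 0. *)
  move: a0; rewrite le_eqVlt => /predU1P[a0|a0].
    by have := prod1 s1 (conj s10 Ls1); rewrite -a0 !mul0r.
  rewrite -ler_pdivrMl//; apply: lb_le_inf; first by exists s1.
  by move=> s Bs; rewrite ler_pdivrMl//; exact: prod1.
apply: (@le_trans _ _ ((expR (- inf A ^+ 2)%R)%:E * (expR (- inf B ^+ 2)%R)%:E)).
  apply: lee_pmul; rewrite ?gauss_layers_ge0//; apply: gauss_layers_le => // r r0 Kr;
    by apply: ge_inf; [case: lbA lbB => _ ? [_]|].
rewrite -EFinM lee_fin mul1r -expRD ler_expR.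
have := sqr_ge0 (inf A - inf B)%R; move: prod2; rewrite sqrrB.
by move: (dot x y) (inf A) (inf B) => u v w; rewrite -mulr_natl; lra.
Qed.

Definition eball n (r : R) : set 'rV[R]_n := [set x | (enorm x <= r)%R].

Lemma enorm_ge0 n (x : 'rV[R]_n) : (0 <= enorm x)%R.
Proof. exact: sqrtr_ge0. Qed.

Lemma enorm_sqr n (x : 'rV[R]_n) : (enorm x ^+ 2 = dot x x)%R.
Proof. by rewrite sqr_sqrtr// dotxx_ge0. Qed.

Lemma enormZ n c (x : 'rV[R]_n) : enorm (c *: x)%R = (`|c| * enorm x)%R.
Proof.
rewrite /enorm dotZl dotZr mulrA -expr2 sqrtrM ?sqr_ge0//.
by rewrite sqrtr_sqr.
Qed.

Lemma measurable_enorm n : measurable_fun [set: 'rV[R]_n] (@enorm R n).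
Proof.
apply: (measurableT_comp (f := @Num.sqrt R)); last exact: measurable_dotxx.
exact: continuous_measurable_fun (@sqrt_continuous R).
Qed.

Lemma measurable_eball n r : measurable (@eball n r).
Proof.
apply: (measurable_bool_set (f := fun x : 'rV[R]_n => (enorm x <= r)%R)).
by apply: measurable_fun_ler => //; exact: measurable_enorm.
Qed.

Lemma eball_scale n r : (0 < r)%R ->
  @eball n r = [set x | @eball n 1 (r^-1 *: x)%R].
Proof.
move=> r0; apply/seteqP; split => x; rewrite /eball/= enormZ ger0_norm ?invr_ge0 ?(ltW r0)//;
  by rewrite ler_pdivrMl// mulr1.
Qed.

Lemma gauss_layers_ball n (x : 'rV[R]_n) :
  gauss_layers (@eball n 1) x = (expR (- dot x x)%R)%:E.
Proof.
rewrite -enorm_sqr -integral_kap ?enorm_ge0//; apply: eq_integral => r _.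
have [r0|r0] := ltP 0%R r; last by rewrite /kap ltNge r0 /ebool !mul0e.
congr (_ * ebool _); apply/asboolP/idP.
- by have := eball_scale n r0; move=> /seteqP[_ /(_ x)]; apply.
- by have := eball_scale n r0; move=> /seteqP[/(_ x) + _]; apply.
Qed.

Lemma integral_gauss_rV n :
  \int[lebesgue_rV n]_x (expR (- dot x x)%R : R)%:E = (Num.sqrt pi ^+ n : R)%:E.
Proof.
have mg m : measurable_fun [set: 'rV[R]_m] (fun x => (expR (- dot x x)%R)%:E).
  by apply: measurable_expR_comp; apply: measurableT_comp => //; exact: measurable_dotxx.
elim: n => [|n IH].
  by rewrite integral_rV0// /dot big_ord0 oppr0 expR0 expr0.
rewrite integral_rV_cons//.
under eq_integral do under eq_integral do
  rewrite dot_cons opprD expRD EFinM.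
transitivity (\int[leb]_s ((expR (- s ^+ 2)%R)%:E * (Num.sqrt pi ^+ n : R)%:E)).
  apply: eq_integral => s _; rewrite ge0_integralZl ?IH//; exact: mg.
rewrite ge0_integralZr//; last first.
- by apply/measurable_EFinP; exact: measurable_gauss_fun.
by rewrite -/gauss1 gauss1E -EFinM -exprS.
Qed.

Definition omega n : \bar R := lebesgue_rV n (@eball n 1).

Let mom n : \bar R := \int[leb]_r (kap r * (r ^+ n)%:E).

Let mom_omega n : mom n * omega n = (Num.sqrt pi ^+ n : R)%:E.
Proof.
rewrite -integral_gauss_rV -integral_gauss_layers; last exact: measurable_eball.
by apply: eq_integral => x _; rewrite gauss_layers_ball.
Qed.

(** Two nonnegative extended reals whose product is a positive real are themselves positive reals;
    thus the ball volume is positive and finite without being computed. *)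
Let mom_omega_fin n : exists m o : R,
  [/\ (0 < m)%R, (0 < o)%R, mom n = m%:E & omega n = o%:E].
Proof.
have m0 : 0 <= mom n.
  apply: integral_ge0 => r _; have [r0|r0] := ltP 0%R r.
    by rewrite mule_ge0 ?kap_ge0// lee_fin exprn_ge0// ltW.
  by rewrite /kap ltNge r0 /ebool !mul0e.
have o0 : 0 <= omega n by exact: measure_ge0.
have p0 : 0 < (Num.sqrt pi ^+ n : R)%:E by rewrite lte_fin exprn_gt0// sqrtr_gt0 pi_gt0.
have := mom_omega n; move: (mom n) (omega n) m0 o0 => m o m0 o0 E.
have {}m0 : 0 < m.
  by rewrite lt_neqAle m0 andbT; apply/eqP => m00; move: p0; rewrite -E -m00 mul0e ltxx.
have {}o0 : 0 < o.
  by rewrite lt_neqAle o0 andbT; apply/eqP => o00; move: p0; rewrite -E -o00 mule0 ltxx.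
case: m m0 E => [m||]// m0; last by rewrite gt0_mulye.
case: o o0 => [p||]// p1; last by rewrite gt0_muley.
by exists m, p; rewrite !lte_fin in m0 p1.
Qed.

Lemma omega_fin n : exists2 o : R, (0 < o)%R & omega n = o%:E.
Proof. by have [m [p [_ p0 _ E]]] := mom_omega_fin n; exists p. Qed.

(** The Gaussian mass is [mom n] times the volume of the unit ball, so the same moments stand on
    both sides of the functional inequality and cancel. *)
Lemma santalo_polar n (K L : set 'rV[R]_n) : measurable K -> measurable L ->
  (forall x, K x -> K (- x)%R) -> (forall x, L x -> L (- x)%R) ->
  (forall x y, K x -> L y -> (dot x y <= 1)%R) ->
  lebesgue_rV n K * lebesgue_rV n L <= omega n * omega n.
Proof.
move=> mK mL eK eL KL.
have even (M : set 'rV[R]_n) : (forall x, M x -> M (- x)%R) ->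
    forall x, gauss_layers M (- x)%R = gauss_layers M x.
  move=> eM x; apply: eq_integral => r _; congr (_ * ebool _).
  apply/asboolP/asboolP; rewrite scalerN; last exact: eM.
  by move=> /eM; rewrite opprK.
have := functional_santalo ltr01 (measurable_gauss_layers mK)
  (measurable_gauss_layers mL) (gauss_layers_ge0 K) (gauss_layers_ge0 L)
  (even _ eK) (even _ eL) (fun x y => gauss_layers_mul x y mK mL KL).
rewrite mul1r expr2 EFinM -mom_omega !integral_gauss_layers// -/(mom n).
have [m [p [m0 _ -> _]]] := mom_omega_fin n.
by rewrite [X in X <= _]muleACA [X in _ <= X]muleACA lee_pmul2l// -EFinM lte_fin mulr_gt0.
Qed.

Lemma santalo_sets n (K L : set 'rV[R]_n) (c : R) : (0 < c)%R ->
  measurable K -> measurable L ->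
  (forall x, K x -> K (- x)%R) -> (forall x, L x -> L (- x)%R) ->
  (forall x y, K x -> L y -> (dot x y <= c)%R) ->
  lebesgue_rV n K * lebesgue_rV n L <= (c ^+ n)%:E * (omega n * omega n).
Proof.
move=> c0 mK mL eK eL KL.
have c1 : (0 < c^-1)%R by rewrite invr_gt0.
have mcL : measurable [set x | L (c *: x)%R].
  by have := @measurable_scale_rV R n c measurableT L mL; rewrite setTI.
have := lebesgue_rV_scale c1 mL; rewrite invrK => E.
have -> : lebesgue_rV n L = (c ^+ n)%:E * lebesgue_rV n [set x | L (c *: x)%R].
  by rewrite E muleA -EFinM exprVn divff ?mul1e// expf_neq0// gt_eqF.
rewrite muleCA lee_wpmul2l ?lee_fin ?exprn_ge0 ?(ltW c0)//.
apply: santalo_polar => // [x /=|x y Kx /= Ly]; first by rewrite scalerN; exact: eL.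
have := KL _ _ Kx Ly; rewrite dotZr => h.
by rewrite -(@ler_pM2l _ c)// mulr1.
Qed.

End volume_product.

(** * The weighted inequality *)

Section weighted.
Context {R : realType} {n : nat} (gamma : R).
Hypothesis hgamma : (0 <= gamma < n%:R)%R.
Local Open Scope ereal_scope.

Let n0 : (0 < n%:R :> R)%R.
Proof. by have /andP[? ?] := hgamma; lra. Qed.

(** The indicator turns the integral over the punctured space into one over the whole space. *)
Definition wrho (x : 'rV[R]_n) : \bar R := ebool (x != 0%R) * (rho gamma x)%:E.

Definition wvol (A : set 'rV[R]_n) : \bar R :=
  \int[lebesgue_rV n]_x (wrho x * ebool `[< A x >]).

Lemma enorm_gt0 (x : 'rV[R]_n) : (0 < enorm x)%R = (x != 0%R).
Proof. by rewrite sqrtr_gt0 lt_neqAle dotxx_ge0 andbT eq_sym dotxx_eq0. Qed.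

Lemma enorm0 : enorm (0 : 'rV[R]_n) = 0%R.
Proof. by rewrite -(scale0r (0 : 'rV[R]_n)) enormZ normr0 mul0r. Qed.

Lemma wrho_ge0 x : 0 <= wrho x.
Proof. by rewrite mule_ge0 ?ebool_ge0// lee_fin divr_ge0// powR_ge0. Qed.

Lemma measurable_neq0 : measurable_fun [set: 'rV[R]_n] (fun x : 'rV[R]_n => x != 0%R).
Proof.
rewrite (_ : (fun x => _) = fun x => (0 < enorm x)%R); last first.
  by apply/funext => x; rewrite enorm_gt0.
by apply: measurable_fun_ltr => //; exact: measurable_enorm.
Qed.

Lemma measurable_wrho : measurable_fun [set: 'rV[R]_n] wrho.
Proof.
apply: emeasurable_funM; first by apply: measurable_ebool; exact: measurable_neq0.
apply/measurable_EFinP; apply: measurable_funM => //.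
apply: (measurableT_comp measurable_invr).
exact: (measurableT_comp (measurable_powR gamma) (@measurable_enorm R n)).
Qed.

Lemma lebesgue_rV_point0 : lebesgue_rV n [set 0%R : 'rV[R]_n] = 0.
Proof.
have := @lebesgue_rV_box R n (fun=> 0%R) (fun=> 0%R) (fun=> lexx _).
rewrite (_ : [set x | _] = [set 0%R]) => [->|].
  case: n n0 => [|m _]; first by rewrite ltxx.
  by rewrite big_const_ord/= subrr mul0r.
apply/seteqP; split => x /=.
  move=> H; apply/rowP => i; have := H i; rewrite in_itv/= mxE => h.
  by apply/eqP; rewrite eq_le andbC.
by move=> -> i; rewrite mxE in_itv/= lexx.
Qed.

Lemma wrhoZ (r : R) (x : 'rV[R]_n) : (0 < r)%R ->
  wrho (r *: x)%R = (r `^ (- gamma))%:E * wrho x.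
Proof.
move=> r0; rewrite /wrho scaler_eq0 gt_eqF//= muleCA; congr (_ * _).
rewrite -EFinM; congr EFin; rewrite /rho enormZ gtr0_norm//.
by rewrite (powRM _ (ltW r0) (enorm_ge0 x)) powRN !div1r invfM.
Qed.

Lemma measurable_wmask (A : set 'rV[R]_n) : measurable A ->
  measurable_fun [set: 'rV[R]_n] (fun x => wrho x * ebool `[< A x >]).
Proof.
move=> mA; apply: emeasurable_funM; first exact: measurable_wrho.
by apply: measurable_ebool; exact: measurable_asbool.
Qed.

Lemma wvol_ball (r : R) : (0 < r)%R ->
  wvol (eball r) = (r `^ (n%:R - gamma))%:E * wvol (eball 1).
Proof.
move=> r0; rewrite /wvol (integral_scale_rV (c := r)) ?gt_eqF//; last 2 first.
- by apply: measurable_wmask; exact: measurable_eball.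
- by move=> x; rewrite mule_ge0 ?wrho_ge0 ?ebool_ge0.
have -> : (r `^ (n%:R - gamma))%:E = (r ^+ n)%:E * (r `^ (- gamma))%:E.
  by rewrite -EFinM -powR_mulrn ?(ltW r0)// -powRD// (gt_eqF r0)// implybT.
rewrite gtr0_norm// -muleA; congr (_ * _).
rewrite -ge0_integralZl//; last 3 first.
- by apply: measurable_wmask; exact: measurable_eball.
- by move=> x _; rewrite mule_ge0 ?wrho_ge0 ?ebool_ge0.
- by rewrite lee_fin powR_ge0.
apply: eq_integral => x _; rewrite wrhoZ// -muleA; congr (_ * (_ * ebool _)).
by rewrite (eball_scale _ r0)/= scalerA mulVf ?gt_eqF// scale1r.
Qed.

(** With t = r^(-gamma), the value of the weight on the sphere, rho 1_K + t 1_B <= rho 1_B + t 1_K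
    holds pointwise off the origin. After integration the terms in t are equal and finite, and
    cancel. *)
Lemma bathtub (K : set 'rV[R]_n) (r : R) : (0 < r)%R -> measurable K ->
  lebesgue_rV n K = lebesgue_rV n (eball r) -> lebesgue_rV n K < +oo ->
  wvol K <= wvol (eball r).
Proof.
move=> r0 mK KB Koo; have [g0 g1] := andP hgamma.
pose t := (r `^ gamma)^-1%R.
have t0 : (0 <= t)%R by rewrite invr_ge0 powR_ge0.
have mB := @measurable_eball R n r.
have mM (A : set 'rV[R]_n) : measurable A ->
    measurable_fun [set: 'rV[R]_n] (fun x => ebool `[< A x >] : \bar R).
  by move=> mA; apply: measurable_ebool; exact: measurable_asbool.
have iM (A : set 'rV[R]_n) : measurable A ->
    \int[lebesgue_rV n]_x (t%:E * ebool `[< A x >]) = t%:E * lebesgue_rV n A.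
  move=> mA; rewrite ge0_integralZl//.
  - rewrite (integral_ebool _ (f := fun x => `[< A x >])); last exact: measurable_asbool.
    by congr (_ * lebesgue_rV n _); apply/seteqP; split => x /= /asboolP.
  - exact: mM.
  - by move=> x _; exact: ebool_ge0.
have finT : t%:E * lebesgue_rV n K \is a fin_num.
  by rewrite fin_numM// ge0_fin_numE.
(* At the origin [wrho] is 0, below the threshold t, so the pointwise comparison could fail there;
   puncturing the ball leaves its volume unchanged. *)
pose B' := eball r `\` [set 0%R : 'rV[R]_n].
have m0 : measurable [set 0%R : 'rV[R]_n].
  have := measurable_bool_set measurable_neq0 => /measurableC.
  congr (measurable _); apply/seteqP; split => x /=; first by move=> /negP/negPn/eqP.
  by move=> ->; rewrite eqxx.
have mB' : measurable B' by exact: measurableD.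
have B'B : lebesgue_rV n B' = lebesgue_rV n K.
  rewrite KB; have -> : eball r = B' `|` [set 0%R : 'rV[R]_n].
    rewrite setUC setDUK// => x ->; by rewrite /eball/= enorm0 ltW.
  rewrite measureU//; last by rewrite setDKI.
  by rewrite [X in _ + X]lebesgue_rV_point0 adde0.
rewrite -(leeD2rE _ _ finT) -{1}B'B -!iM// /wvol -!ge0_integralD//; try by [
  exact: measurable_wmask | move=> x _; rewrite mule_ge0 ?wrho_ge0 ?ebool_ge0 |
  apply: emeasurable_funM => //; exact: mM].
apply: ge0_le_integral => //.
- by move=> x _; rewrite adde_ge0// mule_ge0 ?wrho_ge0 ?ebool_ge0 ?lee_fin.
- apply: emeasurable_funD; first exact: measurable_wmask.
  by apply: emeasurable_funM => //; exact: mM.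
- apply: emeasurable_funD; first exact: measurable_wmask.
  by apply: emeasurable_funM => //; exact: mM.
move=> x _; have [->|x0] := eqVneq x 0%R.
  rewrite /wrho eqxx /ebool !mul0e !add0e.
  case: asboolP => [[_]|_]; first by move=> /(_ erefl).
  by rewrite mule0 mule_ge0// lee_fin.
have xp : (0 < enorm x)%R by rewrite enorm_gt0.
rewrite /wrho x0 mul1e.
have B'E : `[< B' x >] = (enorm x <= r)%R.
  by apply/asboolP/idP => [[]//|xr]; split => //; exact/eqP.
have BE : `[< eball r x >] = (enorm x <= r)%R by apply/asboolP/idP.
rewrite B'E BE /ebool; case: asboolP => _; case: (leP (enorm x) r) => xr;
  rewrite ?mule1 ?mule0 ?adde0 ?add0e//.
- rewrite lee_fin /rho div1r lef_pV2 ?posrE ?powR_gt0//.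
  by rewrite ge0_ler_powR ?nnegrE// ltW.
- rewrite lee_fin /rho div1r lef_pV2 ?posrE ?powR_gt0//.
  by rewrite ge0_ler_powR ?nnegrE// ltW.
Qed.

Definition theta : R := ((n%:R - gamma) / n%:R)%R.

Lemma theta_gt0 : (0 < theta)%R.
Proof. by have /andP[? ?] := hgamma; rewrite divr_gt0// subr_gt0. Qed.

Lemma mul_theta : (n%:R * theta = n%:R - gamma)%R.
Proof. by rewrite /theta mulrC divfK// gt_eqF. Qed.

Lemma wvol_ge0 A : 0 <= wvol A.
Proof. by apply: integral_ge0 => x _; rewrite mule_ge0 ?wrho_ge0 ?ebool_ge0. Qed.

Lemma wvol_null (K : set 'rV[R]_n) : measurable K -> lebesgue_rV n K = 0 -> wvol K = 0.
Proof.
move=> mK K0; transitivity (\int[lebesgue_rV n]_(x in K) wrho x).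
  rewrite [RHS]integral_mkcond; apply: eq_integral => x _.
  rewrite patchE /ebool; case: asboolP => Kx; first by rewrite mem_set// mule1.
  by rewrite memNset// mule0.
by apply: null_set_integral => //; exact: measurable_funTS measurable_wrho.
Qed.

(** Let r be the radius of the ball with the volume of K. Then w(K) is at most a multiple of r^(n -
    gamma), and |L| at most a multiple of (c / r)^n; as n theta = n - gamma, the powers of r
    cancel. *)
Lemma weighted_santalo (K L : set 'rV[R]_n) (c : R) : (0 < c)%R ->
  measurable K -> measurable L -> lebesgue_rV n K < +oo ->
  (forall x, K x -> K (- x)%R) -> (forall x, L x -> L (- x)%R) ->
  (forall x y, K x -> L y -> (dot x y <= c)%R) ->
  wvol K * lebesgue_rV n L `^ theta <=
  wvol (eball 1) * (omega n `^ theta) * (c `^ (n%:R * theta))%:E.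
Proof.
move=> c0 mK mL Koo eK eL KL; have th := theta_gt0.
have KL' := santalo_sets c0 mK mL eK eL KL.
have [w w0 E] := @omega_fin R n; rewrite E in KL' *.
(* For a null K no positive radius exists, but then w(K) = 0, and the left side is 0 even if L has
   infinite volume. *)
have := measure_ge0 (lebesgue_rV n) K; rewrite le_eqVlt => /predU1P[K0|K0].
  by rewrite wvol_null// mul0e !mule_ge0 ?poweR_ge0 ?wvol_ge0// lee_fin powR_ge0.
have [k k0 Ek] : exists2 k : R, (0 < k)%R & lebesgue_rV n K = k%:E.
  have {}K0 : 0 < lebesgue_rV n K by [].
  by exists (fine (lebesgue_rV n K)); rewrite ?fine_gt0 ?K0// fineK// ge0_fin_numE.
pose r := ((k / w) `^ n%:R^-1)%R.
have r0 : (0 < r)%R by rewrite powR_gt0// divr_gt0.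
have rn : (r `^ n%:R = k / w)%R.
  by rewrite -powRrM mulVf ?gt_eqF// powRr1// divr_ge0// ltW.
clearbody r.
have volB : lebesgue_rV n (eball r) = k%:E.
  rewrite (eball_scale _ r0) lebesgue_rV_scale//; last exact: measurable_eball.
  rewrite -/(omega n) E -EFinM -powR_mulrn ?(ltW r0)// rn divfK// gt_eqF//.
have := bathtub r0 mK; rewrite Ek volB => /(_ erefl (ltry _)).
rewrite wvol_ball// => KB.
have Lle : lebesgue_rV n L <= (c `^ n%:R * w * (r `^ n%:R)^-1)%:E.
  move: KL'; rewrite Ek muleC -lee_pdivlMr// -!EFinM => h; apply: (le_trans h).
  rewrite lee_fin rn powR_mulrn ?(ltW c0)// invf_div le_eqVlt; apply/orP; left.
  by apply/eqP; rewrite !mulrA.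
apply: (le_trans (lee_pmul (wvol_ge0 _) (poweR_ge0 _ _) KB
  (le_poweR (ltW th) (measure_ge0 _ _) Lle))).
rewrite !poweR_EFin [leLHS]muleAC -EFinM [leLHS]muleC -[leRHS]muleA -EFinM.
rewrite lee_wpmul2l ?wvol_ge0// lee_fin.
have rg : (0 < r `^ n%:R)%R by rewrite powR_gt0.
rewrite (@powRM _ (c `^ n%:R * w)%R) ?mulr_ge0 ?powR_ge0 ?invr_ge0 ?(ltW w0)//.
rewrite (@powRM _ (c `^ n%:R)%R) ?powR_ge0 ?(ltW w0)// -(powRrM c) -mul_theta.
rewrite -(powR_inv1 (ltW rg)) -!(powRrM r).
have -> : (r `^ (n%:R * theta) * (c `^ (n%:R * theta) * w `^ theta *
   r `^ (n%:R * -1 * theta)) = (r `^ (n%:R * theta) * r `^ (n%:R * -1 * theta)) *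
   (w `^ theta * c `^ (n%:R * theta)))%R by ring.
rewrite -powRD; last by rewrite (gt_eqF r0) implybT.
  by rewrite mulrN1 mulNr subrr powRr0 mul1r.
exact: ltW.
Qed.

End weighted.

(** * The upper bound *)

Section exponential_layers.
Context {R : realType}.
Local Open Scope ereal_scope.

Lemma integral_exp_layer (a : R) (z : \bar R) : (0 < a)%R -> -oo < z ->
  \int[leb]_s ((a * expR (- (a * s)))%:E * ebool (z <= s%:E)) =
  expeR (- (a%:E * z)).
Proof.
move=> a0; case: z => [c _|_|//]; last first.
  rewrite gt0_muley ?lte_fin//=; apply: integral0_eq => s _.
  by rewrite leye_eq /ebool mule0.
have mf : measurable_fun [set: R] (fun s : R => (a * expR (- (a * s)))%:E).
  apply/measurable_EFinP; apply: measurable_funM => //.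
  by apply: measurableT_comp => //; apply: measurableT_comp => //; exact: measurable_funM.
have f0 s : 0 <= (a * expR (- (a * s)))%:E.
  by rewrite lee_fin mulr_ge0 ?expR_ge0// ltW.
transitivity (\int[leb]_(s in `[c, +oo[) (a * expR (- (a * s)))%:E).
  rewrite [RHS]integral_mkcond; apply: eq_integral => s _.
  rewrite patchE mem_setE in_itv/= andbT lee_fin /ebool.
  by case: (leP c s); rewrite ?mule1 ?mule0.
rewrite integral_leb//; last exact: measurable_funTS.
have dF (r : R) : is_derive r 1%R (fun r : R => - expR (- (a * r)))%R
    (a * expR (- (a * r)))%R.
  apply: is_derive_eq; rewrite /GRing.scale/=; ring.
have cg : continuous (fun r : R => expR (- (a * r))).
  move=> r; apply: continuous_comp; last exact: continuous_expR.
  by apply: cvgN; apply: cvgM; [exact: cvg_cst|exact: cvg_id].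
rewrite (@ge0_continuous_FTC2y _ _ (fun r => - expR (- (a * r)))%R c 0).
- by rewrite EFinN oppeK add0e.
- by move=> r _; rewrite mulr_ge0 ?expR_ge0// ltW.
- by apply: continuous_subspaceT => r; apply: cvgM; [exact: cvg_cst|exact: cg].
- rewrite -oppr0; apply: cvgN.
  apply: (@cvg_comp _ _ _ (fun r : R => a * r)%R (fun r => expR (- r)) _
    (pinfty_nbhs R)); last exact: cvgr_expR.
  exact: gt0_cvgMry.
- by move=> r _; exact: ex_derive.
- by apply: cvgN; apply/cvg_at_right_filter; exact: cg.
- by move=> r _; rewrite derive1E; exact: derive_val.
Qed.

Lemma exponential_layers {d} {T : measurableType d}
    (mu : {sigma_finite_measure set T -> \bar R}) (w Psi : T -> \bar R) (a : R) :
  (0 < a)%R -> measurable_fun [set: T] w -> measurable_fun [set: T] Psi ->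
  (forall x, 0 <= w x) -> (forall x, -oo < Psi x) ->
  \int[mu]_x (w x * expeR (- (a%:E * Psi x))) =
  \int[leb]_s ((a * expR (- (a * s)))%:E *
    \int[mu]_x (w x * ebool `[< Psi x <= s%:E >])).
Proof.
move=> a0 mw mP w0 PNy.
have mQ : measurable_fun [set: T * R] (fun p : T * R => Psi p.1 <= p.2%:E).
  apply: measurable_fun_lee; first exact: measurableT_comp.
  by apply/measurable_EFinP.
have mk : measurable_fun [set: R] (fun s : R => (a * expR (- (a * s)))%:E).
  apply/measurable_EFinP; apply: measurable_funM => //.
  by apply: measurableT_comp => //; apply: measurableT_comp => //; exact: measurable_funM.
have := @tonelli_indicator R d T mu w (fun s => (a * expR (- (a * s)))%:E)
  (fun p => Psi p.1 <= p.2%:E) mw mk mQ w0.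
move=> /(_ (fun t => _)) H.
under eq_integral do rewrite -integral_exp_layer//.
rewrite H; last by move=> t; rewrite lee_fin mulr_ge0 ?expR_ge0// ltW.
by apply: eq_integral => s _; congr (_ * _); apply: eq_integral => x _; rewrite asboolb.
Qed.

End exponential_layers.

Section upper_bound.
Context {R : realType} {n : nat} (gamma : R).
Hypothesis hgamma : (0 <= gamma < n%:R)%R.
Local Open Scope ereal_scope.

Let n0 : (0 < n%:R :> R)%R.
Proof. by have /andP[? ?] := hgamma; lra. Qed.

Section class_C_facts.
Context (Phi : 'rV[R]_n -> \bar R).
Hypothesis hPhi : class_C Phi.

Lemma measurable_class_C : measurable_fun [set: 'rV[R]_n] Phi.
Proof.
apply: (measurability _ (ErealGenOInfty.measurableE R)).
move=> /= _ [_ [a ->]] <-; rewrite setTI; apply: open_measurable_rV.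
by rewrite preimage_itvoy; have /lower_semicontinuousP := class_C_lsc hPhi; exact.
Qed.

Lemma open_legendre_gt (a : R) : open [set y | a%:E < legendre Phi y].
Proof.
rewrite (_ : [set y | _] = \bigcup_x [set y | a%:E < (dot x y)%:E - Phi x]).
  apply: bigcup_open => x _; case: (Phi x) (class_C_gtNy hPhi x) => [r _|_|//].
  - rewrite (_ : [set y | _] = dot x @^-1` [set u | (a + r < u)%R]).
      by apply: open_comp; [move=> y _; exact: continuous_dot|exact: open_gt].
    by apply/seteqP; split => y /=; rewrite -EFinB lte_fin ltrBrDr.
  - rewrite (_ : [set y | _] = set0); first exact: open0.
    by rewrite -subset0 => y.
apply/seteqP; split => y /=.
  by move=> /ereal_sup_gt[_ [x _ <-] ax]; exists x.
move=> [x _ ax]; apply: (lt_le_trans ax); apply: ereal_sup_ubound.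
by exists x.
Qed.

Lemma measurable_legendre : measurable_fun [set: 'rV[R]_n] (legendre Phi).
Proof.
apply: (measurability _ (ErealGenOInfty.measurableE R)).
move=> /= _ [_ [a ->]] <-; rewrite setTI; apply: open_measurable_rV.
by rewrite preimage_itvoy; exact: open_legendre_gt.
Qed.

Lemma legendre_gtNy y : -oo < legendre Phi y.
Proof.
have [x /nbhs_singleton/= xoo] := class_C_dom hPhi.
apply: (@lt_le_trans _ _ ((dot x y)%:E - Phi x)).
  by case: (Phi x) xoo (class_C_gtNy hPhi x) => [r _ _| |]//; rewrite -EFinB ltNyr.
by apply: ereal_sup_ubound; exists x.
Qed.

Lemma legendre_even y : legendre Phi (- y)%R = legendre Phi y.
Proof.
have le z : legendre Phi (- z)%R <= legendre Phi z.
  apply: ge_ereal_sup => _ [x _ <-]; apply: ereal_sup_ubound.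
  by exists (- x)%R => //; rewrite (class_C_even hPhi) dotNl dotNr.
by apply/eqP; rewrite eq_le le/=; have := le (- y)%R; rewrite opprK.
Qed.

Lemma sublevel_dot (s t : R) x y : Phi x <= s%:E -> legendre Phi y <= t%:E ->
  (dot x y <= s + t)%R.
Proof.
move=> xs yt; have : (dot x y)%:E - Phi x <= t%:E.
  by apply: le_trans yt; apply: ereal_sup_ubound; exists x.
case: (Phi x) xs (class_C_gtNy hPhi x) => [r| |]//.
by rewrite -EFinB !lee_fin => ? _ ?; lra.
Qed.

Lemma sublevel_finite (s : R) :
  lebesgue_rV n [set x | Phi x <= s%:E] < +oo.
Proof.
have [r rP] := class_C_coercive hPhi s.
have m0 : (0 < Num.max r 1)%R by rewrite lt_max ltr01 orbT.
have [w w0 E] := @omega_fin R n.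
apply: (@le_lt_trans _ _ (lebesgue_rV n (eball (Num.max r 1)%R))).
  apply: le_measure; rewrite ?inE.
  - apply: (measurable_bool_set (f := fun x => Phi x <= s%:E)).
    by apply: measurable_fun_lee => //; exact: measurable_class_C.
  - exact: measurable_eball.
  move=> x /= xs; rewrite /eball/= leNgt; apply/negP => rx.
  have := rP x (le_lt_trans _ rx); rewrite le_max lexx => /(_ erefl).
  by rewrite ltNge xs.
rewrite (eball_scale _ m0) lebesgue_rV_scale//; last exact: measurable_eball.
by rewrite -/(omega n) E -EFinM ltry.
Qed.

End class_C_facts.

Let theta := theta (n := n) gamma.
Definition lam : R := (1 + theta)^-1.

Let th0 : (0 < theta)%R. Proof. exact: theta_gt0. Qed.

Lemma lam_gt0 : (0 < lam)%R.
Proof. by rewrite invr_gt0 ltr_wpDr// ltW. Qed.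

Lemma lam_lt1 : (lam < 1)%R.
Proof. by rewrite invf_lt1 ?ltrDl// ltr_wpDr// ltW. Qed.

Lemma theta_lam : (theta * lam = 1 - lam)%R.
Proof. by rewrite /lam; field; rewrite gt_eqF// ltr_wpDr// ltW. Qed.

(** The power of c that remains when [weighted_santalo] is raised to the power l, because n theta l
    = n (1 - l). *)
Definition expo : R := (n%:R * (1 - lam))%R.

(** An unnormalized Gamma density, the profile that serves as the third function in
    Prekopa-Leindler. *)
Definition gam_kernel (k c : R) : \bar R :=
  ebool (0 < c)%R * (expR (- (k * c)) * c `^ expo)%:E.

Lemma gam_kernel_ge0 k c : 0 <= gam_kernel k c.
Proof. by rewrite mule_ge0 ?ebool_ge0// lee_fin mulr_ge0 ?expR_ge0 ?powR_ge0. Qed.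

Lemma measurable_gam_kernel k : measurable_fun [set: R] (gam_kernel k).
Proof.
apply: emeasurable_funM; first by apply: measurable_ebool; exact: measurable_fun_ltr.
apply/measurable_EFinP; apply: measurable_funM; last exact: measurable_powR.
by apply: measurableT_comp => //; apply: measurableT_comp.
Qed.

Definition BSX (alpha : R) (Phi : 'rV[R]_n -> \bar R) : \bar R :=
  \int[lebesgue_rV n]_(x in ~` [set 0%R])
    (expeR (- (alpha%:E * Phi x)) * (rho gamma x)%:E).

Definition BSY (beta : R) (Phi : 'rV[R]_n -> \bar R) : \bar R :=
  \int[lebesgue_rV n]_y expeR (- (beta%:E * legendre Phi y)).

Lemma BSX_layers alpha Phi : (0 < alpha)%R -> class_C Phi ->
  BSX alpha Phi = \int[leb]_s ((alpha * expR (- (alpha * s)))%:E *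
    wvol gamma [set x | Phi x <= s%:E]).
Proof.
move=> a0 hPhi.
transitivity (\int[lebesgue_rV n]_x (wrho gamma x * expeR (- (alpha%:E * Phi x)))).
  rewrite /BSX integral_mkcond; apply: eq_integral => x _.
  rewrite patchE /wrho; have [->|x0] := eqVneq x 0%R.
    by rewrite memNset ?/ebool ?mul0e//=; apply.
  by rewrite mem_set ?mul1e 1?muleC//=; exact/eqP.
rewrite exponential_layers//; first exact: measurable_wrho.
- exact: measurable_class_C.
- exact: wrho_ge0.
- exact: class_C_gtNy.
Qed.

Lemma BSY_layers beta Phi : (0 < beta)%R -> class_C Phi ->
  BSY beta Phi = \int[leb]_t ((beta * expR (- (beta * t)))%:E *
    lebesgue_rV n [set y | legendre Phi y <= t%:E]).
Proof.
move=> b0 hPhi.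
transitivity (\int[lebesgue_rV n]_y (1 * expeR (- (beta%:E * legendre Phi y)))).
  by apply: eq_integral => y _; rewrite mul1e.
rewrite (@exponential_layers R _ _ (lebesgue_rV n) (cst 1) (legendre Phi) beta)//.
- apply: eq_integral => t _; congr (_ * _).
  under eq_integral do rewrite mul1e.
  rewrite (integral_ebool _ (f := fun y => `[< legendre Phi y <= t%:E >])).
    by congr (lebesgue_rV n _); apply/seteqP; split => y /= /asboolP.
  apply: (measurable_asbool (A := [set y | legendre Phi y <= t%:E])).
  apply: (measurable_bool_set (f := fun y => legendre Phi y <= t%:E)).
  by apply: measurable_fun_lee => //; exact: measurable_legendre.
- exact: measurable_legendre.
- exact: legendre_gtNy.
Qed.

(** Serves levels with s + t <= 0, where Blaschke-Santalo holds for every c > 0. The choice c = (e /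
    w)^(1/n) makes the bound equal to e. *)
Lemma scaled_bound_eq0 (u : \bar R) (w : R) : 0 <= u -> (0 < w)%R ->
  (forall c : R, (0 < c)%R -> u <= (c ^+ n)%:E * w%:E) -> u = 0.
Proof.
move=> u0 w0 H; apply/eqP; rewrite eq_le u0 andbT; apply/lee_addgt0Pr => e e0.
rewrite add0e; apply: (le_trans (H ((e / w) `^ n%:R^-1)%R _)).
  by rewrite powR_gt0// divr_gt0.
rewrite -powR_mulrn ?powR_ge0// -powRrM mulVf ?gt_eqF// powRr1.
  by rewrite -EFinM lee_fin divfK ?gt_eqF.
by rewrite divr_ge0// ltW.
Qed.

End upper_bound.

Section upper_bound_proof.
Context {R : realType} {n : nat} (gamma beta : R).
Hypotheses (hgamma : (0 <= gamma < n%:R)%R) (b0 : (0 < beta)%R).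
Local Open Scope ereal_scope.

Lemma measurable_layer {d} {T : measurableType d}
    (mu : {sigma_finite_measure set T -> \bar R}) (w Psi : T -> \bar R) :
  measurable_fun [set: T] w -> measurable_fun [set: T] Psi ->
  (forall x, 0 <= w x) ->
  measurable_fun [set: R] (fun s => \int[mu]_x (w x * ebool `[< Psi x <= s%:E >])).
Proof.
move=> mw mP w0.
have mQ : measurable_fun [set: T * R]
    (fun p : T * R => w p.1 * ebool `[< Psi p.1 <= p.2%:E >]).
  apply: emeasurable_funM; first exact: (measurableT_comp mw).
  apply: measurable_ebool; under eq_fun do rewrite asboolb.
  apply: measurable_fun_lee; first exact: (measurableT_comp mP).
  by apply/measurable_EFinP.
apply: (@measurable_fun_fubini_tonelli_G _ _ _ _ _ mu _ mQ) => p.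
by rewrite mule_ge0 ?ebool_ge0.
Qed.

Lemma measurable_exp_weight (a : R) :
  measurable_fun [set: R] (fun s : R => (a * expR (- (a * s)))%:E).
Proof.
apply/measurable_EFinP; apply: measurable_funM => //.
by apply: measurableT_comp => //; apply: measurableT_comp => //; exact: measurable_funM.
Qed.

Lemma measurable_BSX_layers (a : R) (Phi : 'rV[R]_n -> \bar R) : class_C Phi ->
  measurable_fun [set: R] (fun s => (a * expR (- (a * s)))%:E *
    wvol gamma [set x | Phi x <= s%:E]).
Proof.
move=> hPhi; apply: emeasurable_funM; first exact: measurable_exp_weight.
apply: (measurable_layer (lebesgue_rV n)); [exact: measurable_wrho|
  exact: measurable_class_C|exact: wrho_ge0].
Qed.

Lemma measurable_BSY_layers (a : R) (Phi : 'rV[R]_n -> \bar R) : class_C Phi ->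
  measurable_fun [set: R] (fun t => (a * expR (- (a * t)))%:E *
    lebesgue_rV n [set y | legendre Phi y <= t%:E]).
Proof.
move=> hPhi; apply: emeasurable_funM; first exact: measurable_exp_weight.
have := @measurable_layer _ _ (lebesgue_rV n) (cst 1) (legendre Phi).
move=> /(_ (measurable_cst _) (measurable_legendre hPhi) (fun=> lee01)).
apply: eq_measurable_fun => t _; under eq_integral do rewrite mul1e.
rewrite (integral_ebool _ (f := fun y => `[< legendre Phi y <= t%:E >])).
  by congr (lebesgue_rV n _); apply/seteqP; split => y /= /asboolP.
apply: (measurable_asbool (A := [set y | legendre Phi y <= t%:E])).
apply: (measurable_bool_set (f := fun y => legendre Phi y <= t%:E)).
by apply: measurable_fun_lee => //; exact: measurable_legendre.
Qed.

Let l := lam (n := n) gamma.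
Let l0 : (0 < l)%R. Proof. exact: lam_gt0. Qed.
Let l1 : (l < 1)%R. Proof. exact: lam_lt1. Qed.
Let m0 : (0 < 1 - l)%R. Proof. by rewrite subr_gt0. Qed.
Let th := theta (n := n) gamma.
Let th0 : (0 < th)%R. Proof. exact: theta_gt0. Qed.
Let thl : (th * l = 1 - l)%R. Proof. exact: theta_lam. Qed.
Let alpha : R := (beta * th)%R.
Let a0 : (0 < alpha)%R. Proof. exact: mulr_gt0. Qed.

(** The number k, which equals both alpha l and beta (1 - l). *)
Definition rate : R := (beta * (1 - lam (n := n) gamma))%R.

Let al : (alpha * l = rate)%R. Proof. by rewrite /alpha -mulrA thl. Qed.

Let rate0 : (0 < rate)%R. Proof. exact: mulr_gt0. Qed.

Definition bound : \bar R := rate%:E *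
  (wvol gamma (@eball R n 1) `^ l * omega n `^ (1 - l)) *
  \int[leb]_c gam_kernel (n := n) gamma rate c.

(** Grouped as (l alpha)^l ((1 - l) beta)^(1 - l), the product has both bases equal to [rate]. *)
Lemma pl_cst_rate : (pl_cst l * (alpha `^ l * beta `^ (1 - l)) = rate)%R.
Proof.
rewrite /pl_cst mulrACA -!powRM ?ltW//.
rewrite (mulrC l) al (mulrC (1 - l)%R) -/rate -powRD ?subrKC ?powRr1 ?(ltW rate0)//.
by rewrite oner_eq0.
Qed.

Lemma layers_mul (Phi : 'rV[R]_n -> \bar R) s t : class_C Phi ->
  wvol gamma [set x | Phi x <= s%:E] `^ l *
  lebesgue_rV n [set y | legendre Phi y <= t%:E] `^ (1 - l) <=
  (wvol gamma (@eball R n 1) `^ l * omega n `^ (1 - l)) *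
  (ebool (0 < s + t)%R * ((s + t) `^ expo (n := n) gamma)%:E).
Proof.
move=> hPhi.
set K := [set x | _]; set L := [set y | _].
have mK : measurable K.
  apply: (measurable_bool_set (f := fun x => Phi x <= s%:E)).
  by apply: measurable_fun_lee => //; exact: measurable_class_C.
have mL : measurable L.
  apply: (measurable_bool_set (f := fun y => legendre Phi y <= t%:E)).
  by apply: measurable_fun_lee => //; exact: measurable_legendre.
have Koo : lebesgue_rV n K < +oo by exact: sublevel_finite.
have eK x : K x -> K (- x)%R by rewrite /K/= (class_C_even hPhi).
have eL y : L y -> L (- y)%R by rewrite /L/= legendre_even.
have KL x y : K x -> L y -> (dot x y <= s + t)%R by exact: sublevel_dot.
have W0 := @wvol_ge0 R n gamma; have V0 A := measure_ge0 (@lebesgue_rV R n) A.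
have [w w0 E] := @omega_fin R n.
have [c0|c0] := ltP 0%R (s + t)%R.
  have := weighted_santalo hgamma c0 mK mL Koo eK eL KL.
  move=> /(le_poweR (ltW l0) (mule_ge0 (W0 _) (poweR_ge0 _ _))).
  rewrite /ebool mul1e !poweRM ?mule_ge0 ?poweR_ge0 ?W0//; last 1 first.
  - by rewrite lee_fin powR_ge0.
  rewrite -!poweRrM poweR_EFin -powRrM -/th thl -[(_ * th * l)%R]mulrA thl.
  by [].
(* Now <x, y> <= s + t <= 0 on K x L, hence <x, y> <= c for every c > 0; the product of the volumes
   is 0, and one of the two factors vanishes. *)
rewrite /ebool mul0e mule0.
have : lebesgue_rV n K * lebesgue_rV n L = 0.
  apply: (scaled_bound_eq0 hgamma (w := (w * w)%R)); rewrite ?mule_ge0 ?mulr_gt0//.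
  move=> c cp; have := santalo_sets cp mK mL eK eL.
  rewrite E -EFinM; apply => x y Kx Ly; apply: (le_trans (KL _ _ Kx Ly)).
  exact: le_trans (ltW cp).
move=> /eqP; rewrite mule_eq0 => /orP[/eqP K0|/eqP ->].
  by rewrite (wvol_null gamma mK K0) poweR0r ?mul0e// gt_eqF.
by rewrite (@poweR0r _ (1 - l)%R) ?mule0// gt_eqF.
Qed.

Lemma BS_upper (Phi : 'rV[R]_n -> \bar R) : class_C Phi ->
  BSX gamma alpha Phi `^ l * BSY beta Phi `^ (1 - l) <= bound.
Proof.
move=> hPhi; rewrite (BSX_layers gamma a0 hPhi) (BSY_layers b0 hPhi).
pose N := wvol gamma (@eball R n 1) `^ l * omega n `^ (1 - l).
have N0 : 0 <= N by rewrite mule_ge0 ?poweR_ge0.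
have k0 s : 0 <= gam_kernel (n := n) gamma rate s by exact: gam_kernel_ge0.
have mk : measurable_fun [set: R] (gam_kernel (n := n) gamma rate).
  exact: measurable_gam_kernel.
have c0 : (0 <= alpha `^ l * beta `^ (1 - l))%R by rewrite mulr_ge0 ?powR_ge0.
have e0 (a s : R) : (0 < a)%R -> 0 <= (a * expR (- (a * s)))%:E.
  by move=> ap; rewrite lee_fin mulr_ge0 ?expR_ge0// ltW.
have -> : bound = (pl_cst l)%:E * \int[leb]_c
    ((alpha `^ l * beta `^ (1 - l))%:E * N * gam_kernel (n := n) gamma rate c).
  rewrite ge0_integralZl ?mule_ge0 ?poweR_ge0 ?lee_fin//.
  by rewrite !muleA -EFinM pl_cst_rate /bound /N !muleA.
apply: prekopa_leindler1.
- by rewrite l0.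
- exact: measurable_BSX_layers.
- exact: measurable_BSY_layers.
- exact: emeasurable_funM.
- by move=> s; rewrite mule_ge0 ?e0// wvol_ge0.
- by move=> t; rewrite mule_ge0 ?e0.
- by move=> c; rewrite mule_ge0 ?k0// mule_ge0 ?N0// lee_fin.
move=> s t; rewrite !poweRM ?e0 ?wvol_ge0// !poweR_EFin muleACA.
have -> : ((alpha * expR (- (alpha * s))) `^ l)%:E *
    ((beta * expR (- (beta * t))) `^ (1 - l))%:E =
    (alpha `^ l * beta `^ (1 - l))%:E * (expR (- (rate * (s + t))))%:E.
  (* This is where alpha = theta beta enters: both exponents have the rate k, so the exponentials
     merge into one in s + t. *)
  rewrite -!EFinM (powRM _ (ltW a0) (expR_ge0 _)) (powRM _ (ltW b0) (expR_ge0 _)).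
  rewrite mulrACA -!expRM -expRD; congr (_ * expR _)%:E.
  have r2 : rate = (beta * (1 - l))%R by [].
  by rewrite (mulrDr rate) -{1}al r2; ring.
rewrite -[leLHS]muleA -[leRHS]muleA lee_wpmul2l ?lee_fin//.
apply: (@le_trans _ _ ((expR (- (rate * (s + t))))%:E * (N *
  (ebool (0 < s + t)%R * ((s + t) `^ expo (n := n) gamma)%:E)))).
  by rewrite lee_wpmul2l ?lee_fin ?expR_ge0//; exact: layers_mul.
by rewrite [leLHS]muleCA lee_wpmul2l// /gam_kernel EFinM [leLHS]muleCA.
Qed.

End upper_bound_proof.

(** * The maximizer *)

Section euclidean.
Context {R : realType} {n : nat}.
Implicit Types x y : 'rV[R]_n.

Lemma dot_le_enorm x y : dot x y <= enorm x * enorm y.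
Proof.
have [->|x0] := eqVneq x 0.
  by rewrite enorm0 mul0r /dot big1// => i _; rewrite mxE mul0r.
have [->|y0] := eqVneq y 0.
  by rewrite enorm0 mulr0 /dot big1// => i _; rewrite mxE mulr0.
have xy0 : 0 < 2 * (enorm x * enorm y) by rewrite !mulr_gt0 ?enorm_gt0.
rewrite -subr_ge0 -(pmulr_rge0 _ xy0).
(* This square expands to 2 |x| |y| (|x| |y| - <x, y>), the goal after multiplication by the
   positive [xy0]. *)
have := dotxx_ge0 (enorm y *: x - enorm x *: y).
rewrite !(dotDl, dotDr, dotNl, dotNr, dotZl, dotZr) (dotC y x) -!enorm_sqr.
by lra.
Qed.

Lemma enormD x y : enorm (x + y) <= enorm x + enorm y.
Proof.
rewrite -(@ler_pXn2r _ 2) ?nnegrE ?addr_ge0 ?enorm_ge0// enorm_sqr.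
rewrite !(dotDl, dotDr) (dotC y x) -!enorm_sqr.
have := dot_le_enorm x y; rewrite sqrrD -mulr_natl; lra.
Qed.

Lemma continuous_enorm : continuous (@enorm R n).
Proof.
move=> x; apply: (@continuous_comp _ _ _ (fun x => dot x x) Num.sqrt); last exact: sqrt_continuous.
rewrite /dot; apply: (continuous_big (op := +%R)) => [|i _]; first exact: add_continuous.
by move=> y; exact: (cvgM (@continuous_coord R n i y) (@continuous_coord R n i y)).
Qed.

End euclidean.

Section maximizer.
Context {R : realType} {n : nat} (l : R).
Hypothesis l01 : 0 < l < 1.
Local Open Scope ereal_scope.

Let l0 : (0 < l)%R. Proof. by case/andP: l01. Qed.
Let m0 : (0 < 1 - l)%R. Proof. by rewrite subr_gt0; case/andP: l01. Qed.

(** The exponents 1/l and 1/(1 - l) are conjugate, so the Legendre transform has the same form with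
    l replaced by 1 - l; sublevel sets of both are balls. *)
Definition power_potential (x : 'rV[R]_n) : \bar R := (l * enorm x `^ l^-1)%:E.

Lemma power_potential_le x (s : R) : (0 <= s)%R ->
  (power_potential x <= s%:E) = (enorm x <= (l^-1 * s) `^ l)%R.
Proof.
move=> s0; rewrite /power_potential lee_fin mulrC -ler_pdivlMr// mulrC.
have ls0 : (0 <= l^-1 * s)%R by rewrite mulr_ge0// invr_ge0 ltW.
apply/idP/idP => h.
- have := @ge0_ler_powR _ l (ltW l0) _ _ _ _ h.
  rewrite -powRrM mulVf ?gt_eqF// powRr1 ?enorm_ge0//; apply; rewrite nnegrE//.
  exact: powR_ge0.
- have li : (0 <= l^-1)%R by rewrite invr_ge0 ltW.
  have := @ge0_ler_powR _ l^-1%R li _ _ _ _ h.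
  rewrite -powRrM mulfV ?gt_eqF// powRr1//; apply; rewrite nnegrE ?enorm_ge0//.
  exact: powR_ge0.
Qed.

Lemma power_potential_ge0 x : 0 <= power_potential x.
Proof. by rewrite lee_fin mulr_ge0 ?powR_ge0// ltW. Qed.

Lemma class_C_power_potential : class_C power_potential.
Proof.
have lt_pp x (a : R) : (0 <= a)%R ->
    (a%:E < power_potential x) = ((l^-1 * a) `^ l < enorm x)%R.
  by move=> a0; rewrite !ltNge power_potential_le.
split.
- by move=> x; rewrite /power_potential ltNyr.
- apply/lower_semicontinuousP => a; have [a0|a0] := ltP a 0%R.
    rewrite (_ : [set x | _] = setT); first exact: openT.
    apply/seteqP; split => // x _ /=; apply: lt_le_trans (power_potential_ge0 x).
    by rewrite lte_fin.
  rewrite (_ : [set x | _] = @enorm R n @^-1` [set u | ((l^-1 * a) `^ l < u)%R]).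
    by apply: open_comp; [move=> y _; exact: continuous_enorm|exact: open_gt].
  by apply/seteqP; split => x /=; rewrite lt_pp.
- by move=> x; rewrite /power_potential -scaleN1r enormZ normrN normr1 mul1r.
- move=> x y t /andP[t0 t1].
  rewrite /power_potential -!EFinM -EFinD lee_fin.
  have t1' : (0 <= 1 - t)%R by rewrite subr_ge0.
  have p1 : (1 <= l^-1)%R by rewrite invf_ge1// ltW//; case/andP: l01.
  have p0 : (0 <= l^-1)%R by rewrite invr_ge0 ltW.
  rewrite mulrCA (mulrCA (1 - t)%R) -mulrDr ler_pM2l//.
  apply: (@le_trans _ _ ((t * enorm x + (1 - t) * enorm y) `^ l^-1)%R).
    apply: ge0_ler_powR; rewrite ?nnegrE ?addr_ge0 ?mulr_ge0 ?enorm_ge0//.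
    by apply: (le_trans (enormD _ _)); rewrite !enormZ !ger0_norm.
  have := @convex_powR R l^-1%R p1 (Itv01 t0 t1) (enorm x) (enorm y).
  by rewrite !inE/= !in_itv/= !enorm_ge0 !convRE/=; apply.
- exists 0%R; rewrite (_ : [set x | _] = setT) ?interiorT//.
  by apply/seteqP; split => // x _; rewrite /= ltry.
- move=> M; exists ((l^-1 * Num.max M 0) `^ l)%R => x Mx.
  apply: (@le_lt_trans _ _ (Num.max M 0)%:E); first by rewrite lee_fin le_max lexx.
  by rewrite lt_pp// le_max lexx orbT.
Qed.

Lemma radial_power_potential : radial power_potential.
Proof. by move=> x y; rewrite /power_potential => ->. Qed.

(** Cauchy-Schwarz followed by Young's inequality. An upper bound on the transform is the direction
    that bounds the second integral from below. *)
Lemma legendre_power_potential y :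
  legendre power_potential y <= ((1 - l) * enorm y `^ (1 - l)^-1)%:E.
Proof.
apply: ge_ereal_sup => _ [x _ <-]; rewrite /power_potential -EFinB lee_fin.
rewrite lerBlDr; apply: (le_trans (dot_le_enorm x y)).
have := @conjugate_powR R (enorm x) (enorm y) l^-1%R (1 - l)^-1%R (enorm_ge0 _) (enorm_ge0 _).
rewrite !invr_gt0 !invrK subrKC => /(_ l0 m0 erefl); lra.
Qed.

End maximizer.

Section attained.
Context {R : realType} {n : nat} (gamma beta : R).
Hypotheses (hgamma : (0 <= gamma < n%:R)%R) (b0 : (0 < beta)%R).
Local Open Scope ereal_scope.

Let l := lam (n := n) gamma.
Let l0 : (0 < l)%R. Proof. exact: lam_gt0. Qed.
Let l1 : (l < 1)%R. Proof. exact: lam_lt1. Qed.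
Let l01 : (0 < l < 1)%R. Proof. by rewrite l0. Qed.
Let m0 : (0 < 1 - l)%R. Proof. by rewrite subr_gt0. Qed.
Let th := theta (n := n) gamma.
Let th0 : (0 < th)%R. Proof. exact: theta_gt0. Qed.
Let thl : (th * l = 1 - l)%R. Proof. exact: theta_lam. Qed.
Let alpha : R := (beta * th)%R.
Let a0 : (0 < alpha)%R. Proof. exact: mulr_gt0. Qed.
Let k : R := rate (n := n) gamma beta.
Let kE : (k = beta * (1 - l))%R. Proof. by []. Qed.
Let al : (alpha * l = k)%R. Proof. by rewrite /alpha -mulrA thl. Qed.
Let k0 : (0 < k)%R. Proof. exact: mulr_gt0. Qed.
Let Phi0 : 'rV[R]_n -> \bar R := power_potential l.
Let hPhi0 : class_C Phi0. Proof. exact: class_C_power_potential. Qed.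
Let J : \bar R := \int[leb]_c gam_kernel (n := n) gamma k c.
Let N : \bar R := wvol gamma (@eball R n 1).

Lemma integral_gam_kernel_scale (q : R) : (0 < q)%R ->
  \int[leb]_s gam_kernel (n := n) gamma k (q^-1 * s)%R = q%:E * J.
Proof.
move=> q0; rewrite /J [in RHS](integral_affine_pos (c := q^-1%R) 0) ?invr_gt0//.
- rewrite muleA -EFinM divff ?gt_eqF// mul1e.
  by under [RHS]eq_integral do rewrite addr0.
- exact: measurable_gam_kernel.
- by move=> c; exact: gam_kernel_ge0.
Qed.

(* [k / q = a] is the relation which makes the layers of the power function
   dilates of the common profile [gam_kernel]. *)
Lemma layers_ge (a q : R) (v : \bar R) (V : R -> \bar R) :
  (0 < a)%R -> (0 < q)%R -> (a * q = k)%R -> 0 <= v -> (forall s, 0 <= V s) ->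
  measurable_fun [set: R] (fun s => (a * expR (- (a * s)))%:E * V s) ->
  (forall s, (0 < s)%R -> ((q^-1 * s) `^ expo (n := n) gamma)%:E * v <= V s) ->
  k%:E * v * J <= \int[leb]_s ((a * expR (- (a * s)))%:E * V s).
Proof.
move=> a_gt0 q0 aq v0 V0 mV vV.
have mker : measurable_fun [set: R] (fun s => gam_kernel (n := n) gamma k (q^-1 * s)%R).
  apply: (measurableT_comp (f := gam_kernel gamma k)); first exact: measurable_gam_kernel.
  exact: measurable_funM.
have e0 s : (0 <= a * expR (- (a * s)))%R by rewrite mulr_ge0 ?expR_ge0// ltW.
have av0 : 0 <= a%:E * v by rewrite mule_ge0// lee_fin ltW.
have ker0 s : [set: R] s -> 0 <= gam_kernel (n := n) gamma k (q^-1 * s)%R.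
  by move=> _; exact: gam_kernel_ge0.
have -> : k%:E * v * J = \int[leb]_s (a%:E * v *
    gam_kernel (n := n) gamma k (q^-1 * s)%R).
  rewrite (ge0_integralZl leb measurableT mker ker0 av0).
  by rewrite integral_gam_kernel_scale// -aq EFinM -!muleA; congr (_ * _); rewrite muleCA.
apply: ge0_le_integral => //.
- by move=> s _; rewrite mule_ge0 ?gam_kernel_ge0// mule_ge0// lee_fin ltW.
- exact: emeasurable_funM.
move=> s _; rewrite /gam_kernel; have [s0|s0] := ltP 0%R s; last first.
  rewrite ltNge pmulr_rle0 ?invr_gt0// s0 /ebool mul0e mule0.
  by rewrite mule_ge0// lee_fin.
rewrite pmulr_rgt0 ?invr_gt0// s0 /ebool mul1e.
rewrite (mulrA k) (_ : k / q = a)%R; last by rewrite -aq mulfK// gt_eqF.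
rewrite EFinM muleACA -EFinM lee_wpmul2l ?lee_fin//.
by rewrite muleC; exact: vV.
Qed.

Lemma BSX_power_potential : k%:E * N * J <= BSX gamma alpha Phi0.
Proof.
rewrite (BSX_layers gamma a0 hPhi0); apply: (layers_ge (q := l)) => //.
- exact: wvol_ge0.
- by move=> s; exact: wvol_ge0.
- exact: measurable_BSX_layers.
move=> s s0.
have q0 : (0 < (l^-1 * s) `^ l)%R by rewrite powR_gt0// mulr_gt0// invr_gt0.
rewrite (_ : [set x | _] = eball ((l^-1 * s) `^ l)%R); last first.
  by apply/seteqP; split => x /=; rewrite power_potential_le// ltW.
rewrite wvol_ball// -powRrM /expo -/l -thl.
suff -> : (l * (n%:R - gamma) = n%:R * (th * l))%R by [].
(* The ball has radius (s / l)^l, hence weighted volume of degree l (n - gamma) = n theta l in s,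
   which is [expo]. *)
by rewrite -(mul_theta hgamma) -/th; ring.
Qed.

Lemma BSY_power_potential : k%:E * omega n * J <= BSY beta Phi0.
Proof.
rewrite (BSY_layers b0 hPhi0); apply: (layers_ge (q := (1 - l)%R)) => //.
- exact: measurable_BSY_layers.
move=> s s0.
have q0 : (0 < ((1 - l)^-1 * s) `^ (1 - l))%R by rewrite powR_gt0// mulr_gt0// invr_gt0.
have -> : (((1 - l)^-1 * s) `^ expo (n := n) gamma)%:E * omega n =
    lebesgue_rV n (eball (((1 - l)^-1 * s) `^ (1 - l))%R).
  rewrite (eball_scale _ q0) lebesgue_rV_scale//; last exact: measurable_eball.
  by rewrite -powR_mulrn ?(ltW q0)// -powRrM /expo (mulrC n%:R).
apply: le_measure; rewrite ?inE.
- exact: measurable_eball.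
- apply: (measurable_bool_set (f := fun y => legendre Phi0 y <= s%:E)).
  by apply: measurable_fun_lee => //; exact: measurable_legendre.
(* The sublevel set of the transform contains the ball on which (1 - l) |y|^(1/(1 - l)) <= s. *)
move=> y yB /=; apply: (le_trans (legendre_power_potential l01 y)).
have m01 : (0 < 1 - l < 1)%R by rewrite m0 ltrBlDr ltrDl.
by have := power_potential_le m01 y (ltW s0); rewrite /power_potential => ->.
Qed.

Lemma bound_le_BS_power_potential :
  bound (n := n) gamma beta <= BSX gamma alpha Phi0 `^ l * BSY beta Phi0 `^ (1 - l).
Proof.
have N0 : 0 <= N by exact: wvol_ge0.
have o0 : 0 <= omega n :> \bar R by exact: measure_ge0.
have J0 : 0 <= J by apply: integral_ge0 => c _; exact: gam_kernel_ge0.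
have kk0 : 0 <= k%:E by rewrite lee_fin ltW.
have split (z : \bar R) : 0 <= z -> z = z `^ l * z `^ (1 - l).
  move=> z0; rewrite -poweRD ?subrKC ?poweRe1//.
  by apply: add_neq0_poweRD_def; rewrite subrKC oner_eq0.
apply: (@le_trans _ _ ((k%:E * N * J) `^ l * (k%:E * omega n * J) `^ (1 - l))).
  (* Each of k and J occurs once in [bound]; writing it as its l-th times its (1 - l)-th power
     distributes it over the two integrals. *)
  rewrite /bound -/l -/N -/k -/J {1}(split _ kk0) {1}(split _ J0).
  rewrite !poweRM ?mule_ge0//.
  rewrite le_eqVlt; apply/orP; left; apply/eqP.
  rewrite [LHS]muleACA -!muleA; congr (_ * _).
  by rewrite [LHS]muleCA [RHS]muleCA; congr (_ * _); rewrite muleCA.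
apply: lee_pmul; rewrite ?poweR_ge0// le_poweR ?mule_ge0 ?(ltW l0) ?(ltW m0)//.
- exact: BSX_power_potential.
- exact: BSY_power_potential.
Qed.

(** Here 1/alpha = l/k and 1/beta = (1 - l)/k. As the power 1/k is monotone, maximizing the
    functional amounts to maximizing the product bounded in [BS_upper]. *)
Lemma BS_eq (Phi : 'rV[R]_n -> \bar R) :
  BS alpha beta (rho gamma) Phi =
  (BSX gamma alpha Phi `^ l * BSY beta Phi `^ (1 - l)) `^ k^-1.
Proof.
rewrite poweRM ?poweR_ge0// -!poweRrM /BS -/(BSX gamma alpha Phi) -/(BSY beta Phi).
congr (_ `^ _ * _ `^ _).
- by rewrite -al; field; rewrite !gt_eqF.
- by rewrite kE; field; rewrite !gt_eqF.
Qed.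

Lemma BS_power_potential_max (Phi : 'rV[R]_n -> \bar R) : class_C Phi ->
  BS alpha beta (rho gamma) Phi <= BS alpha beta (rho gamma) Phi0.
Proof.
move=> hPhi; rewrite !BS_eq le_poweR ?mule_ge0 ?poweR_ge0 ?invr_ge0 ?(ltW k0)//.
exact: (le_trans (BS_upper hgamma b0 hPhi) bound_le_BS_power_potential).
Qed.

End attained.

Theorem theorem5p10 (R : realType) (n : nat) (gamma beta : R)
    (hgamma : 0 <= gamma < n%:R) (hbeta : 0 < beta) :
  let alpha := beta * ((n%:R - gamma) / n%:R) in
  exists Phi0 : 'rV[R]_n -> \bar R,
    [/\ class_C Phi0, radial Phi0 &
        BS alpha beta (rho gamma) Phi0 =
        ereal_sup [set BS alpha beta (rho gamma) Phi | Phi in @class_C R n]].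
Proof.
move=> alpha.
have l01 : 0 < lam (n := n) gamma < 1 by rewrite lam_gt0//= lam_lt1.
exists (power_potential (lam (n := n) gamma)); split.
- exact: class_C_power_potential.
- exact: radial_power_potential.
apply/eqP; rewrite eq_le; apply/andP; split.
  apply: ereal_sup_ubound; exists (power_potential (lam (n := n) gamma)) => //.
  exact: class_C_power_potential.
apply: ge_ereal_sup => _ [Phi hPhi <-].
exact: BS_power_potential_max.
Qed.
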